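(* Let $(M,g)$ be a tangential hypersurface, with unit normal vector field $N$, of a locally product-like statistical manifold $(\widetilde{M},\widetilde{g},\widetilde{\nabla},F)$. Then for every $X\in\Gamma(TM)$: $$\nabla_{X}\xi=-\varphi(A_{N}X)+\kappa(X)\xi,$$ $$\nabla^{\ast}_{X}\xi^{\ast}=-\varphi^{\ast}(A^{\ast}_{N}X)-\kappa(X)\xi^{\ast},$$ $$\eta(A^{\ast}_{N}X)+\eta^{\ast}(A_{N}X)=0,\qquad A_{N}\xi^{\ast}+A^{\ast}_{N}\xi=0,$$ $$\kappa(X)=\eta^{\ast}(\nabla_{X}\xi)=-\eta(\nabla^{\ast}_{X}\xi^{\ast}).$$
   Context: A statistical manifold $(\widetilde{M},\widetilde{g},\widetilde{\nabla})$ is a Riemannian manifold with a torsion-free affine connection $\widetilde{\nabla}$ such that $\widetilde{\nabla}\widetilde{g}$ is totally symmetric. The dual connection $\widetilde{\nabla}^{\ast}$ is defined by $Z\widetilde{g}(X,Y)=\widetilde{g}(X,\widetilde{\nabla}^{\ast}_{Z}Y)+\widetilde{g}(\widetilde{\nabla}_{Z}X,Y)$; it is also torsion-free. A locally product-like statistical manifold $(\widetilde{M},\widetilde{g},\widetilde{\nabla},F)$ is a statistical manifold with a $(1,1)$-tensor field $F$ satisfying $F^{2}=I$ and $\widetilde{\nabla}F=0$, together with the $(1,1)$-tensor field $F^{\ast}$ satisfying $\widetilde{g}(FX,Y)=\widetilde{g}(X,F^{\ast}Y)$. A hypersurface $(M,g)$ (induced metric $g$, unit normal $N$) is tangential if $FN$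 and $F^{\ast}N$ are tangent to $M$. Then put $\xi=FN$, $\xi^{\ast}=F^{\ast}N$, and for $X\in\Gamma(TM)$ write $FX=\varphi X+\eta^{\ast}(X)N$, $F^{\ast}X=\varphi^{\ast}X+\eta(X)N$ with $\varphi X,\varphi^{\ast}X$ tangent to $M$ and $\eta,\eta^{\ast}$ $1$-forms on $M$ (so $\eta(X)=g(X,\xi)$, $\eta^{\ast}(X)=g(X,\xi^{\ast})$). The Gauss and Weingarten formulas, for $X,Y\in\Gamma(TM)$, are $$\widetilde{\nabla}_{X}Y=\nabla_{X}Y+g(A^{\ast}_{N}X,Y)N,\quad \widetilde{\nabla}_{X}N=-A_{N}X+\kappa(X)N,$$ $$\widetilde{\nabla}^{\ast}_{X}Y=\nabla^{\ast}_{X}Y+g(A_{N}X,Y)N,\quad \widetilde{\nabla}^{\ast}_{X}N=-A^{\ast}_{N}X-\kappa(X)N,$$ which define the induced connections $\nabla,\nabla^{\ast}$ on $M$, the shape operators $A_{N},A^{\ast}_{N}$ and the $1$-form $\kappa$ on $M$. *)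

(* Defs.v *)
From HB Require Import structures.
From mathcomp Require Import all_boot all_order all_algebra.
From mathcomp Require Import all_classical all_reals all_analysis.
Import Order.TTheory GRing.Theory Num.Theory numFieldNormedType.Exports.

Set Implicit Arguments.
Unset Strict Implicit.
Unset Printing Implicit Defensive.

Local Open Scope classical_set_scope.
Local Open Scope ring_scope.

(* C^oo on an open set A: all iterated directional derivatives of f are
   differentiable at every point of A. *)
Definition smooth_on (R : realType) (V W : normedModType R)
    (A : set V) (f : V -> W) : Prop :=
  forall (us : seq V) (x : V), A x ->
    differentiable (foldl (fun (h : V -> W) (u : V) => 'D_u h) f us) x.

(* chart_map and chart_inv are total functions, meaningful only on chart_dom
   and on its image respectively. *)
Record chart (R : realType) (n : nat) (M : topologicalType) := Chart {
  chart_dom : set M;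
  chart_map :> M -> 'rV[R]_n;
  chart_inv : 'rV[R]_n -> M;
  chart_dom_open : open chart_dom;
  chart_img_open : open (chart_map @` chart_dom);
  chart_mapK : {in chart_dom, cancel chart_map chart_inv};
  chart_map_continuous : {within chart_dom, continuous chart_map};
  chart_inv_continuous :
    {within chart_map @` chart_dom, continuous chart_inv}
}.

(* The atlas need not be maximal; the smoothness notions below are the same
   for an atlas and for the maximal atlas it generates. *)
Record manifold (R : realType) (n : nat) := Manifold {
  manifold_space :> topologicalType;
  manifold_hausdorff : hausdorff_space manifold_space;
  manifold_second_countable : @second_countable manifold_space;
  atlas : set (chart R n manifold_space);
  atlas_cover : forall p : manifold_space,
    exists c, atlas c /\ chart_dom c p;
  atlas_smooth : forall c d, atlas c -> atlas d ->
    smooth_on (c @` (chart_dom c `&` chart_dom d)) (d \o chart_inv c)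
}.

Arguments atlas {R n} m _.

(* A chosen chart of the atlas around p. *)
Definition chart_at (R : realType) (n : nat) (M : manifold R n) (p : M) :
    chart R n M :=
  sval (cid (atlas_cover p)).

(* A tangent vector at p is given by its components in the chart chart_at p;
   its components in another chart at p are then given by coords below. *)
Definition tangent (R : realType) (n : nat) (M : manifold R n) (p : M) :
    lmodType R :=
  'rV[R]_n.

Definition coords (R : realType) (n : nat) (M : manifold R n)
    (c : chart R n M) (p : M) (v : tangent p) : 'rV[R]_n :=
  'd (c \o chart_inv (chart_at p)) (chart_at p p) v.

(* The derivative v(f) of the function f along the tangent vector v. *)
Definition tderiv (R : realType) (n : nat) (M : manifold R n)
    (p : M) (v : tangent p) (f : M -> R) : R :=
  'd ((f : M -> R^o) \o chart_inv (chart_at p)) (chart_at p p) v.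

Definition differential (R : realType) (m n : nat)
    (M : manifold R m) (N : manifold R n) (i : M -> N) (x : M) :
    {linear tangent x -> tangent (i x)} :=
  'd (chart_at (i x) \o i \o chart_inv (chart_at x)) (chart_at x x).

Definition smooth_fun (R : realType) (n : nat) (M : manifold R n)
    (f : M -> R) : Prop :=
  forall c, atlas M c ->
    smooth_on (c @` chart_dom c) ((f : M -> R^o) \o chart_inv c).

Definition smooth_map (R : realType) (m n : nat)
    (M : manifold R m) (N : manifold R n) (i : M -> N) : Prop :=
  continuous i /\
  forall c d, atlas M c -> atlas N d ->
    smooth_on (c @` (chart_dom c `&` i @^-1` chart_dom d))
      (d \o i \o chart_inv c).

(* Sections of the pull-back bundle i^*TN, and, for i the identity, of TM. *)
Definition vfield_along (R : realType) (m n : nat)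
    (M : manifold R m) (N : manifold R n) (i : M -> N) : Type :=
  forall x : M, tangent (i x).

Definition vfield (R : realType) (n : nat) (M : manifold R n) : Type :=
  vfield_along (idfun : M -> M).

Definition smooth_along (R : realType) (m n : nat)
    (M : manifold R m) (N : manifold R n) (i : M -> N)
    (V : vfield_along i) : Prop :=
  forall c d, atlas M c -> atlas N d ->
    smooth_on (c @` (chart_dom c `&` i @^-1` chart_dom d))
      (fun u => coords d (V (chart_inv c u))).

(* Membership in Gamma(TM). *)
Definition smooth_vfield (R : realType) (n : nat) (M : manifold R n)
    (X : vfield M) : Prop :=
  smooth_along X.

Definition pushforward (R : realType) (m n : nat)
    (M : manifold R m) (N : manifold R n) (i : M -> N) (X : vfield M) :
    vfield_along i :=
  fun x => differential i x (X x).

Record tensor11 (R : realType) (n : nat) (M : manifold R n) := Tensor11 {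
  tensor11_map :> forall p : M, {linear tangent p -> tangent p};
  tensor11_smooth : forall X : vfield M, smooth_vfield X ->
    smooth_vfield (fun p => tensor11_map p (X p))
}.

Record one_form (R : realType) (n : nat) (M : manifold R n) := OneForm {
  one_form_map :> forall p : M, {scalar tangent p};
  one_form_smooth : forall X : vfield M, smooth_vfield X ->
    smooth_fun (fun p => one_form_map p (X p))
}.

Record riemannian_metric (R : realType) (n : nat) (M : manifold R n) :=
    RiemannianMetric {
  metric_form :> forall p : M, tangent p -> tangent p -> R;
  metric_linear : forall (p : M) (u : tangent p), scalar (metric_form u);
  metric_symmetric : forall (p : M) (u v : tangent p),
    metric_form u v = metric_form v u;
  metric_pos : forall (p : M) (u : tangent p), u != 0 -> 0 < metric_form u u;
  metric_smooth : forall X Y : vfield M,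
    smooth_vfield X -> smooth_vfield Y ->
    smooth_fun (fun p => metric_form (X p) (Y p))
}.

(* A connection on the pull-back bundle i^*TN. The axioms concern smooth
   arguments; the values at non-smooth arguments are irrelevant. *)
Record connection_along (R : realType) (m n : nat)
    (M : manifold R m) (N : manifold R n) (i : M -> N) := ConnectionAlong {
  cov :> vfield M -> vfield_along i -> vfield_along i;
  cov_smooth : forall (X : vfield M) (V : vfield_along i),
    smooth_vfield X -> smooth_along V -> smooth_along (cov X V);
  cov_addl : forall (X Y : vfield M) (V : vfield_along i),
    smooth_vfield X -> smooth_vfield Y -> smooth_along V ->
    forall x, cov (fun y => X y + Y y) V x = cov X V x + cov Y V x;
  cov_scalel : forall (f : M -> R) (X : vfield M) (V : vfield_along i),
    smooth_fun f -> smooth_vfield X -> smooth_along V ->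
    forall x, cov (fun y => f y *: X y) V x = f x *: cov X V x;
  cov_addr : forall (X : vfield M) (V W : vfield_along i),
    smooth_vfield X -> smooth_along V -> smooth_along W ->
    forall x, cov X (fun y => V y + W y) x = cov X V x + cov X W x;
  cov_leibniz : forall (f : M -> R) (X : vfield M) (V : vfield_along i),
    smooth_fun f -> smooth_vfield X -> smooth_along V ->
    forall x, cov X (fun y => f y *: V y) x =
      tderiv (X x) f *: V x + f x *: cov X V x
}.

Definition connection (R : realType) (n : nat) (M : manifold R n) : Type :=
  connection_along (idfun : M -> M).

(* D is the pull-back of nabla to i^*TN: the connection on i^*TN which maps
   the field Y o i to nabla_{di(X)} Y, for Y a vector field on N. *)
Definition is_pullback_connection (R : realType) (m n : nat)
    (M : manifold R m) (N : manifold R n) (i : M -> N)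
    (nabla : connection N) (D : connection_along i) : Prop :=
  forall (X : vfield M) (X' Y : vfield N),
    smooth_vfield X -> smooth_vfield X' -> smooth_vfield Y ->
    forall x : M, X' (i x) = differential i x (X x) ->
      D X (fun y => Y (i y)) x = nabla X' Y (i x).

(* nabla_X Y - nabla_Y X = [X, Y], where [X, Y] f = X (Y f) - Y (X f). *)
Definition torsion_free (R : realType) (n : nat) (M : manifold R n)
    (nabla : connection M) : Prop :=
  forall (X Y : vfield M) (f : M -> R),
    smooth_vfield X -> smooth_vfield Y -> smooth_fun f ->
    forall p : M,
      tderiv (nabla X Y p - nabla Y X p) f =
      tderiv (X p) (fun q => tderiv (Y q) f) -
      tderiv (Y p) (fun q => tderiv (X q) f).

(* (nabla_X g)(Y, Z) *)
Definition cov_metric (R : realType) (n : nat) (M : manifold R n)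
    (g : riemannian_metric M) (nabla : connection M) (X Y Z : vfield M) (p : M) : R :=
  tderiv (X p) (fun q => g q (Y q) (Z q))
  - g p (nabla X Y p) (Z p) - g p (Y p) (nabla X Z p).

Definition statistical (R : realType) (n : nat) (M : manifold R n)
    (g : riemannian_metric M) (nabla : connection M) : Prop :=
  torsion_free nabla /\
  forall X Y Z : vfield M,
    smooth_vfield X -> smooth_vfield Y -> smooth_vfield Z ->
    forall p : M,
      cov_metric g nabla X Y Z p = cov_metric g nabla Y X Z p /\
      cov_metric g nabla X Y Z p = cov_metric g nabla X Z Y p.

Definition dual_connections (R : realType) (n : nat) (M : manifold R n)
    (g : riemannian_metric M) (nabla nablas : connection M) : Prop :=
  forall X Y Z : vfield M,
    smooth_vfield X -> smooth_vfield Y -> smooth_vfield Z ->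
    forall p : M,
      tderiv (Z p) (fun q => g q (X q) (Y q)) =
      g p (X p) (nablas Z Y p) + g p (nabla Z X p) (Y p).

Definition parallel11 (R : realType) (n : nat) (M : manifold R n)
    (nabla : connection M) (F : tensor11 M) : Prop :=
  forall X Y : vfield M, smooth_vfield X -> smooth_vfield Y ->
    forall p : M,
      nabla X (fun q => F q (Y q)) p - F p (nabla X Y p) = 0.

Definition adjoint11 (R : realType) (n : nat) (M : manifold R n)
    (g : riemannian_metric M) (F Fs : tensor11 M) : Prop :=
  forall (p : M) (u v : tangent p), g p (F p u) v = g p u (Fs p v).

Definition locally_product_like_statistical (R : realType) (n : nat)
    (M : manifold R n) (g : riemannian_metric M) (nabla : connection M)
    (F : tensor11 M) : Prop :=
  [/\ statistical g nabla,
      forall (p : M) (u : tangent p), F p (F p u) = u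
    & parallel11 nabla F].

Definition immersion (R : realType) (m n : nat)
    (M : manifold R m) (N : manifold R n) (i : M -> N) : Prop :=
  smooth_map i /\ forall x : M, injective (differential i x).

Definition induced_metric (R : realType) (m n : nat)
    (M : manifold R m) (N : manifold R n) (g : riemannian_metric N) (i : M -> N)
    (x : M) (u v : tangent x) : R :=
  g (i x) (differential i x u) (differential i x v).

Definition unit_normal (R : realType) (n : nat)
    (M : manifold R n) (M' : manifold R n.+1) (g : riemannian_metric M') (i : M -> M')
    (N : vfield_along i) : Prop :=
  [/\ smooth_along N,
      forall x : M, g (i x) (N x) (N x) = 1
    & forall (x : M) (v : tangent x), g (i x) (differential i x v) (N x) = 0].

Definition tangential (R : realType) (n : nat)
    (M : manifold R n) (M' : manifold R n.+1) (i : M -> M')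
    (F Fs : tensor11 M') (N : vfield_along i) : Prop :=
  forall x : M,
    (exists v : tangent x, F (i x) (N x) = differential i x v) /\
    (exists v : tangent x, Fs (i x) (N x) = differential i x v).

(* xi = F N, and F X = phi X + eta(X) N for X tangent to M. *)
Definition induced_structure (R : realType) (n : nat)
    (M : manifold R n) (M' : manifold R n.+1) (i : M -> M')
    (N : vfield_along i) (F : tensor11 M')
    (xi : vfield M) (phi : tensor11 M) (eta : one_form M) : Prop :=
  [/\ smooth_vfield xi,
      forall x : M, differential i x (xi x) = F (i x) (N x)
    & forall (x : M) (v : tangent x),
        F (i x) (differential i x v) =
        differential i x (phi x v) + eta x v *: N x].

(* Here D, Ds are the connections on i^*TM' induced by the dual connections of
   the ambient manifold M'. *)
Definition gauss_weingarten (R : realType) (n : nat)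
    (M : manifold R n) (M' : manifold R n.+1) (g : riemannian_metric M') (i : M -> M')
    (N : vfield_along i) (D Ds : connection_along i)
    (nabla nablas : connection M) (A As : tensor11 M) (kappa : one_form M) :
    Prop :=
  [/\ forall X Y : vfield M, smooth_vfield X -> smooth_vfield Y ->
        forall x : M, D X (pushforward i Y) x =
          differential i x (nabla X Y x)
          + induced_metric g i (As x (X x)) (Y x) *: N x,
      forall X : vfield M, smooth_vfield X ->
        forall x : M, D X N x =
          - differential i x (A x (X x)) + kappa x (X x) *: N x,
      forall X Y : vfield M, smooth_vfield X -> smooth_vfield Y ->
        forall x : M, Ds X (pushforward i Y) x =
          differential i x (nablas X Y x)
          + induced_metric g i (A x (X x)) (Y x) *: N x
    & forall X : vfield M, smooth_vfield X ->
        forall x : M, Ds X N x =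
          - differential i x (As x (X x)) - kappa x (X x) *: N x].

(* Main.v *)
Require Import Defs.
From HB Require Import structures.
From mathcomp Require Import all_boot all_order all_algebra.
From mathcomp Require Import all_classical all_reals all_analysis.
From mathcomp Require Import ring lra.
Import Order.TTheory GRing.Theory Num.Theory numFieldNormedType.Exports.

Set Implicit Arguments.
Unset Strict Implicit.
Unset Printing Implicit Defensive.

Local Open Scope ring_scope.
Local Open Scope classical_set_scope.

(** On the ambient manifold nabla F = 0 gives D (F N) = F (D N) for the
    pulled-back connection D, and duality gives the same for nabla* and F*.
    As F N is the push-forward of xi, the Gauss formula on the left, the
    Weingarten formula and F X = phi X + eta*(X) N on the right, yield the
    first formula (tangential part) and eta(A* X) + eta*(A X) = 0 (normal
    part); F^2 = 1 then gives kappa.  The identity A xi* + A* xi = 0 follows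
    from the normal part because A and A* are self-adjoint, which is the
    absence of torsion of the pulled-back connections.

    Since N and the push-forwards i_* X are not restrictions of ambient fields,
    each identity for D is obtained by writing a section V along i, near a
    point, as a combination of restrictions of global fields; these are
    coordinate fields cut off by a smooth bump function. *)

(** * Functions of class C^k and smooth functions *)

(** A [connection_along] carries no locality axiom, and [is_pullback_connection] speaks only of
    restrictions of global fields. Passing to a cut-off section f V therefore costs Leibniz terms in
    the derivative of f, and each argument is arranged so that these terms occur on both sides and
    cancel. No bracket of sections along i is at hand, so the torsion of D is read off from its
    action on functions, through the defect (D_X V) h - X(V h). This is why symmetry of second
    derivatives and separation of tangent vectors by smooth functions are developed. Tangent vectors
    are stored by components in a chart chosen at their base point, a choice that need not depend
    continuously on the point; smoothness is visible only after passing to one fixed chart with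
    [coords]. For the dual half, absence of torsion of nabla* comes from the total symmetry of nabla
    g. *)

Lemma near_eq_is_diff (R : realType) (V W : normedModType R) (f g : V -> W)
    (x : V) :
  (\near x, f x = g x) -> differentiable f x ->
  differentiable g x /\ 'd g x = 'd f x :> (V -> W).
Proof.
move=> fg df; have fgx : f x = g x := nbhs_singleton fg.
have dg : g \o shift x = cst (g x) + 'd f x +o_ 0 id.
  apply/eqaddoP => e e0; have /eqaddoP/(_ e e0) := diff_locally df.
  have fg0 : \forall y \near 0, f (y + x) = g (y + x).
    by move: fg; rewrite (near_shift 0 x); apply: filterS => y /=; rewrite subr0.
  apply: filterS2 fg0 => y /= fgy.
  by rewrite -[X in `|X|]/(f (y + x) - (f x + 'd f x y))
    -[X in _ -> `|X| <= _]/(g (y + x) - (g x + 'd f x y)) fgy fgx.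
have dE : 'd g x = 'd f x :> (V -> W).
  by apply: diff_unique dg; exact: diff_continuous.
split=> //; apply/diff_locallyP; rewrite dE; split=> //.
exact: diff_continuous.
Qed.

Lemma open_eq_near (T : topologicalType) (U : Type) (A : set T) (f g : T -> U)
    (x : T) :
  open A -> (forall y, A y -> f y = g y) -> A x -> \near x, f x = g x.
Proof. by move=> oA fg Ax; apply: filterS fg _; exact: open_nbhs_nbhs. Qed.

Lemma open_eq_derive (R : realType) (V W : normedModType R) (A : set V)
    (f g : V -> W) (x u : V) :
  open A -> (forall y, A y -> f y = g y) -> A x -> 'D_u f x = 'D_u g x.
Proof. by move=> oA fg Ax; apply/near_eq_derive/(open_eq_near oA). Qed.

Section ck.
Context {R : realType} {V : normedModType R}.
Variable A : set V.
Hypothesis oA : open A.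

(** Order 0 imposes nothing, order k asks for k successive differentiations. Counting gives the
    induction for the product and chain rules: these keep undifferentiated factors, which [ckW]
    supplies at the lower order. *)
Fixpoint ck {W : normedModType R} (k : nat) (f : V -> W) : Prop :=
  if k is k'.+1 then
    (forall x, A x -> differentiable f x) /\ forall u, ck k' ('D_u f)
  else True.

Lemma smooth_onP (W : normedModType R) (f : V -> W) :
  smooth_on A f <-> forall k, ck k f.
Proof.
split=> [fs k|fck us x Ax].
  elim: k f fs => //= k IH f fs; split=> [x Ax|u]; first exact: (fs [::] x).
  by apply: IH => us x Ax; exact: (fs (u :: us) x).
have {fck} := fck (size us).+1.
elim: us f => [|u us IH] f; first by case=> + _; exact.
by case=> _ /(_ u) /IH.
Qed.

Lemma ckW (W : normedModType R) k (f : V -> W) : ck k.+1 f -> ck k f.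
Proof.
elim: k f => //= k IH f [df D]; split=> // u; apply: IH; exact: D.
Qed.

Lemma ck_ext (W : normedModType R) k (f g : V -> W) :
  (forall x, A x -> f x = g x) -> ck k f -> ck k g.
Proof.
elim: k f g => //= k IH f g fg [df D]; split=> [x Ax|u].
  exact: (near_eq_is_diff (open_eq_near oA fg Ax) (df x Ax)).1.
apply: IH (D u) => x Ax; exact: (open_eq_derive _ oA).
Qed.

Lemma ck_cst (W : normedModType R) k (w : W) : ck k (fun _ : V => w).
Proof.
elim: k w => //= k IH w; split=> [x _|u]; first exact: differentiable_cst.
by apply: ck_ext (IH 0) => x _; rewrite derive_cst.
Qed.

Lemma ckD (W : normedModType R) k (f g : V -> W) :
  ck k f -> ck k g -> ck k (fun x => f x + g x).
Proof.
elim: k f g => //= k IH f g cf cg; have [[df Df] [dg Dg]] := (cf, cg).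
split=> [x Ax|u]; first by apply: differentiableD; [exact: df|exact: dg].
apply: ck_ext (IH _ _ (Df u) (Dg u)) => x Ax.
by rewrite -[RHS]/('D_u (f + g) x) deriveD //; apply/diff_derivable;
  [exact: df|exact: dg].
Qed.

Lemma ck_sum (W : normedModType R) k (I : Type) (r : seq I) (f : I -> V -> W) :
  (forall i, ck k (f i)) -> ck k (fun x => \sum_(i <- r) f i x).
Proof.
move=> cf; elim: r => [|i r IH].
  by apply: ck_ext (ck_cst k 0) => x _; rewrite big_nil.
by apply: ck_ext (ckD (cf i) IH) => x _; rewrite big_cons.
Qed.

Lemma ckM k (f g : V -> R^o) :
  ck k f -> ck k g -> ck k (fun x => f x * g x : R^o).
Proof.
elim: k f g => //= k IH f g cf cg; have [[df Df] [dg Dg]] := (cf, cg).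
split=> [x Ax|u]; first by apply: differentiableM; [exact: df|exact: dg].
apply: ck_ext (ckD (IH _ _ (ckW cf) (Dg u)) (IH _ _ (ckW cg) (Df u))) => x Ax.
by rewrite -[RHS]/('D_u (f * g) x) deriveM //; apply/diff_derivable;
  [exact: df|exact: dg].
Qed.

Lemma ckZl (W : normedModType R) k (f : V -> R^o) (w : W) :
  ck k f -> ck k (fun x => f x *: w).
Proof.
elim: k f => //= k IH f [df Df]; split=> [x Ax|u].
  by apply: differentiableZl; exact: df.
apply: ck_ext (IH _ (Df u)) => x Ax.
have dfx := df x Ax; have dz := differentiableZl w dfx.
by rewrite [RHS]deriveE// diffZl//= deriveE.
Qed.

Lemma ck_coord k p q (f : V -> 'M[R]_(p, q)) i j :
  ck k f -> ck k (fun x => f x i j : R^o).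
Proof.
elim: k f => //= k IH f [df Df]; split=> [x Ax|u].
  apply: (@differentiable_comp _ _ _ _ f (fun N : 'M[R]_(p, q) => N i j : R^o)).
    exact: df.
  exact: differentiable_coord.
apply: ck_ext (IH _ (Df u)) => x Ax.
by rewrite derive_mx ?mxE//; apply/diff_derivable/df.
Qed.

Lemma ck_mx k p q (f : V -> 'M[R]_(p, q)) :
  (forall i j, ck k (fun x => f x i j : R^o)) -> ck k f.
Proof.
move=> cf; apply: ck_ext (ck_sum (index_enum _) (fun i =>
  ck_sum (index_enum _) (fun j => ckZl (delta_mx i j) (cf i j)))) => x _.
by rewrite -matrix_sum_delta.
Qed.

End ck.

(** The chain rule writes D_u(g o f) as the sum over j of D_u f_j times (D_j g) o f, so the
    induction hypothesis is applied to the partial derivatives of g. *)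
Lemma ck_comp (R : realType) (V : normedModType R) (A : set V) (p : nat)
    (B : set 'rV[R]_p) k (f : V -> 'rV[R]_p) (g : 'rV[R]_p -> R^o) :
  open A -> open B -> (forall x, A x -> B (f x)) ->
  ck A k f -> ck B k g -> ck A k (g \o f).
Proof.
move=> oA oB fAB; elim: k g => //= k IH g cf cg.
have [[df Df] [dg Dg]] := (cf, cg); split=> [x Ax|u].
  by apply: differentiable_comp; [exact: df|apply: dg; exact: fAB].
apply: (ck_ext oA) (ck_sum oA (index_enum _) (fun j => ckM oA
  (ck_coord oA 0 j (Df u)) (IH _ (ckW cf) (Dg (delta_mx 0 j))))) => x Ax.
have dfx := df x Ax; have dgx := dg _ (fAB _ Ax).
rewrite [RHS]deriveE; last exact: differentiable_comp.
rewrite diff_comp//= -(deriveE u dfx) [in RHS](row_sum_delta ('D_u f x)) linear_sum.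
by apply: eq_bigr => j _; rewrite linearZ/= -(deriveE (delta_mx 0 j) dgx).
Qed.

Section smooth_on.
Context {R : realType}.
Implicit Types V W : normedModType R.

Lemma smooth_on_subset V W (A B : set V) (f : V -> W) :
  B `<=` A -> smooth_on A f -> smooth_on B f.
Proof. by move=> BA fs us x /BA; exact: fs. Qed.

Lemma smooth_on_local V W (A : set V) (f : V -> W) :
  (forall x, A x -> exists B (g : V -> W), [/\ open B, B x,
     forall y, B y -> g y = f y & smooth_on B g]) -> smooth_on A f.
Proof.
move=> loc us x /loc[B [g [oB Bx gf gs]]].
have : smooth_on B f.
  by apply/smooth_onP => k; apply: (ck_ext oB gf); move: k; exact/smooth_onP.
exact.
Qed.

Lemma smooth_on_ext V W (A : set V) (f g : V -> W) :
  open A -> (forall x, A x -> f x = g x) -> smooth_on A f -> smooth_on A g.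
Proof. by move=> oA fg fs; apply: smooth_on_local => x Ax; exists A, f. Qed.

Lemma smooth_on_differentiable V W (A : set V) (f : V -> W) x :
  smooth_on A f -> A x -> differentiable f x.
Proof. by move=> /(_ [::]); exact. Qed.

Lemma smooth_on_derive V W (A : set V) (f : V -> W) u :
  smooth_on A f -> smooth_on A ('D_u f).
Proof. by move=> fs us; exact: (fs (u :: us)). Qed.

Lemma smooth_on_cst V W (A : set V) (w : W) :
  open A -> smooth_on A (fun=> w).
Proof. by move=> oA; apply/smooth_onP => k; exact: ck_cst. Qed.

Lemma smooth_on_id V (A : set V) : open A -> smooth_on A (fun x : V => x).
Proof.
move=> oA; apply/smooth_onP => -[//|k]; split=> [x _|u].
  exact: (is_diff_id x).(ex_diff).
apply: (ck_ext oA) (ck_cst oA k u) => x _.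
by rewrite derive_id.
Qed.

Lemma smooth_onD V W (A : set V) (f g : V -> W) : open A ->
  smooth_on A f -> smooth_on A g -> smooth_on A (fun x => f x + g x).
Proof.
by move=> oA /smooth_onP fs /smooth_onP gs; apply/smooth_onP => k; exact: ckD.
Qed.

Lemma smooth_on_sum V W (A : set V) (I : Type) (r : seq I) (f : I -> V -> W) :
  open A -> (forall i, smooth_on A (f i)) ->
  smooth_on A (fun x => \sum_(i <- r) f i x).
Proof.
move=> oA fs; apply/smooth_onP => k; apply: ck_sum => // i.
by move: k; exact/smooth_onP.
Qed.

Lemma smooth_onM V (A : set V) (f g : V -> R^o) : open A ->
  smooth_on A f -> smooth_on A g -> smooth_on A (fun x => f x * g x : R^o).
Proof.
by move=> oA /smooth_onP fs /smooth_onP gs; apply/smooth_onP => k; exact: ckM.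
Qed.

Lemma smooth_on_mxP V p q (A : set V) (f : V -> 'M[R]_(p, q)) : open A ->
  smooth_on A f <-> forall i j, smooth_on A (fun x => f x i j : R^o).
Proof.
move=> oA; split=> [/smooth_onP fs i j|fs]; apply/smooth_onP => k.
  exact: ck_coord.
by apply: ck_mx => // i j; move: k; exact/smooth_onP.
Qed.

Lemma smooth_onZ V p q (A : set V) (f : V -> R^o) (g : V -> 'M[R]_(p, q)) :
  open A -> smooth_on A f -> smooth_on A g ->
  smooth_on A (fun x => f x *: g x).
Proof.
move=> oA fs /(smooth_on_mxP _ oA) gs; apply/smooth_on_mxP => // i j.
apply: smooth_on_ext (smooth_onM oA fs (gs i j)) => // x _.
by rewrite mxE.
Qed.

Lemma smooth_on_comp V p (A : set V) (B : set 'rV[R]_p) (f : V -> 'rV[R]_p)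
    (g : 'rV[R]_p -> R^o) :
  open A -> open B -> (forall x, A x -> B (f x)) ->
  smooth_on A f -> smooth_on B g -> smooth_on A (g \o f).
Proof.
move=> oA oB fAB /smooth_onP fs /smooth_onP gs; apply/smooth_onP => k.
exact: (ck_comp oA oB).
Qed.

Lemma smooth_on_comp_mx V p q r (A : set V) (B : set 'rV[R]_p)
    (f : V -> 'rV[R]_p) (g : 'rV[R]_p -> 'M[R]_(q, r)) :
  open A -> open B -> (forall x, A x -> B (f x)) ->
  smooth_on A f -> smooth_on B g -> smooth_on A (g \o f).
Proof.
move=> oA oB fAB fs /(smooth_on_mxP _ oB) gs; apply/smooth_on_mxP => // i j.
exact: (smooth_on_comp oA oB fAB fs (gs i j)).
Qed.

Lemma diff_sum_delta W p (g : 'rV[R]_p -> W) (x v : 'rV[R]_p) :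
  differentiable g x ->
  'd g x v = \sum_j v 0 j *: 'D_(delta_mx 0 j) g x.
Proof.
move=> dg; rewrite [in LHS](row_sum_delta v) linear_sum.
by apply: eq_bigr => j _; rewrite linearZ/= -(deriveE _ dg).
Qed.

(** Base point and vector both vary, so the differential is expanded in the partial derivatives of
    g, with the components of w as coefficients. *)
Lemma smooth_on_diff V p (A : set V) (B : set 'rV[R]_p)
    (f w : V -> 'rV[R]_p) (g : 'rV[R]_p -> R^o) :
  open A -> open B -> (forall x, A x -> B (f x)) ->
  smooth_on A f -> smooth_on A w -> smooth_on B g ->
  smooth_on A (fun x => 'd g (f x) (w x)).
Proof.
move=> oA oB fAB fs /(smooth_on_mxP _ oA) ws gs.
apply: (smooth_on_ext oA _ (smooth_on_sum (index_enum _) oA (fun j =>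
  smooth_onM oA (ws 0 j) (smooth_on_comp oA oB fAB fs
    (smooth_on_derive (delta_mx 0 j) gs))))) => x Ax.
by rewrite diff_sum_delta//; apply: (smooth_on_differentiable gs); exact: fAB.
Qed.

Lemma smooth_on_diff_mx V p q r (A : set V) (B : set 'rV[R]_p)
    (f w : V -> 'rV[R]_p) (g : 'rV[R]_p -> 'M[R]_(q, r)) :
  open A -> open B -> (forall x, A x -> B (f x)) ->
  smooth_on A f -> smooth_on A w -> smooth_on B g ->
  smooth_on A (fun x => 'd g (f x) (w x)).
Proof.
move=> oA oB fAB fs /(smooth_on_mxP _ oA) ws gs.
apply: (smooth_on_ext oA _ (smooth_on_sum (index_enum _) oA (fun j =>
  smooth_onZ oA (ws 0 j) (smooth_on_comp_mx oA oB fAB fs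
    (smooth_on_derive (delta_mx 0 j) gs))))) => x Ax.
by rewrite diff_sum_delta//; apply: (smooth_on_differentiable gs); exact: fAB.
Qed.

End smooth_on.

(** * Symmetry of second derivatives *)

Section mixed_derivatives.
Context {R : realType} {V : normedModType R}.

Lemma mean_value_line (g : V -> R^o) (y v : V) (h : R) : 0 < h ->
  (forall t : R, 0 <= t <= h -> differentiable g (t *: v + y)) ->
  exists2 t : R, 0 < t < h & g (h *: v + y) - g y = 'D_v g (t *: v + y) * h.
Proof.
move=> h0 dg; pose l (t : R) : V := t *: v + y.
have dl (t : R) : differentiable l t by [].
have glD t : 0 <= t <= h -> is_derive t 1 (g \o l) ('D_v g (l t)).
  move=> th; have dgl := differentiable_comp (dl t) (dg t th).
  apply: DeriveDef; first exact/derivable1_diffP.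
  rewrite deriveE// diff_comp//=; last exact: dg.
  rewrite -[in RHS](scale1r v) deriveE; last exact: dg.
  by rewrite {1}/l diff_val /= addr0.
have [t||t] := @MVT R (g \o l) (fun t => 'D_v g (l t)) 0 h h0.
- by rewrite in_itv/= => /andP[t0 th]; apply: glD; rewrite !ltW.
- apply: continuous_in_subspaceT => t /set_mem/=; rewrite in_itv/= => th.
  apply: differentiable_continuous.
  by apply: differentiable_comp => //; exact: dg.
- by rewrite in_itv/= /l /= scale0r add0r subr0 => th gE; exists t.
Qed.

(** Two mean values: in direction u for the increment y |-> f(h v + y) - f(y), then in direction v
    for D_u f. *)
Lemma second_difference (f : V -> R^o) (A : set V) (x u v : V) (h : R) :
  open A -> smooth_on A f -> 0 < h ->
  (forall s t : R, 0 <= s <= h -> 0 <= t <= h -> A (s *: u + (t *: v + x))) ->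
  exists s t : R, [/\ 0 < s < h, 0 < t < h &
    f (h *: u + (h *: v + x)) - f (h *: u + x) - (f (h *: v + x) - f x) =
    'D_v ('D_u f) (s *: u + (t *: v + x)) * h * h].
Proof.
move=> oA fs h0 hA; have hh : 0 <= h <= h by rewrite lexx ltW.
have h00 : 0 <= (0 : R) <= h by rewrite lexx ltW.
pose g y : R^o := f (h *: v + y) - f y.
have tr (z : V) : (fun y => f (z + y)) = f \o shift z.
  by apply/funext => y /=; rewrite addrC.
have sh (z y : V) : is_diff y (shift z) id.
  have -> : shift z = (fun y : V => y) + cst z by [].
  have : id + 0 = id :> (V -> V) by apply/funext => ?; rewrite /GRing.add/= addr0.
  by move=> {2}<-; exact: is_diffD.
have df y : A y -> differentiable f y by exact: smooth_on_differentiable.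
have dft (z y : V) : A (z + y) -> differentiable (fun y => f (z + y)) y /\
    'D_u (fun y => f (z + y)) y = 'D_u f (z + y).
  move=> Azy; have dfc : differentiable (f \o shift z) y.
    by apply: differentiable_comp; rewrite /= ?[y + z]addrC; [|exact: df].
  rewrite tr; split=> //; rewrite deriveE// diff_comp//= ?[y + z]addrC; last exact: df.
  by rewrite diff_val -deriveE//; exact: df.
have dfv s : 0 <= s <= h -> A (h *: v + (s *: u + x)).
  by move=> sh0; rewrite addrCA; exact: hA.
have dfu s : 0 <= s <= h -> A (s *: u + x).
  by move=> sh0; have := hA s 0 sh0 h00; rewrite scale0r add0r.
have dg s : 0 <= s <= h -> differentiable g (s *: u + x).
  move=> sh0; apply: differentiableB; first exact: (dft _ _ (dfv _ sh0)).1.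
  exact/df/dfu.
have [s sh0] := mean_value_line h0 dg.
have sh1 : 0 <= s <= h by case/andP: sh0 => *; rewrite !ltW.
have -> : 'D_u g (s *: u + x) =
    'D_u f (h *: v + (s *: u + x)) - 'D_u f (s *: u + x).
  have [d1 <-] := dft _ _ (dfv _ sh1).
  have d2 := df _ (dfu _ sh1).
  rewrite -[LHS]/('D_u ((fun y => f (h *: v + y)) - f) _) deriveB//;
  exact/diff_derivable.
have [t th0|t th0 gt] := @mean_value_line ('D_u f) (s *: u + x) v h h0.
  apply: (smooth_on_differentiable (smooth_on_derive u fs)).
  by rewrite addrCA; exact: hA.
rewrite gt /g [h *: v + (h *: u + x)]addrCA [t *: v + _]addrCA => gE.
by exists s, t; split=> //; rewrite -gE !opprB !addrA.
Qed.

(** The second difference over a small parallelogram is symmetric in u and v, so the two mixed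
    derivatives agree when each is taken at a suitable point of it; their continuity at x does the
    rest. *)
Lemma derive_commute (f : V -> R^o) (A : set V) (x u v : V) :
  open A -> A x -> smooth_on A f ->
  'D_u ('D_v f) x = 'D_v ('D_u f) x.
Proof.
move=> oA Ax fs; apply/eqP; rewrite -subr_eq0 -normr_le0.
apply/ler_addgt0Pl => e e0; rewrite addr0.
have e2 : 0 < e / 2 by rewrite divr_gt0.
have cont w1 w2 : \forall y \near x, `|'D_w1 ('D_w2 f) x - 'D_w1 ('D_w2 f) y| < e / 2.
  have /smooth_on_differentiable/(_ Ax)/differentiable_continuous :=
    smooth_on_derive w1 (smooth_on_derive w2 fs).
  by move/cvgrPdist_lt; exact.
have /nbhs_ballP[d /= d0 dA] : nbhs x (A `&`
    [set y | `|'D_u ('D_v f) x - 'D_u ('D_v f) y| < e / 2] `&`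
    [set y | `|'D_v ('D_u f) x - 'D_v ('D_u f) y| < e / 2]).
  apply: filterI; last exact: cont.
  by apply: filterI; [exact: open_nbhs_nbhs|exact: cont].
(* The parallelogram stays within h(|u| + |v|) < d of x; the added 1 makes this strict and the
   denominator positive. *)
pose h := d / (`|u| + `|v| + 1).
have den0 : 0 < `|u| + `|v| + 1 by rewrite ltr_wpDl// addr_ge0.
have h0 : 0 < h by rewrite divr_gt0.
have hball s t : 0 <= s <= h -> 0 <= t <= h -> ball x d (s *: u + (t *: v + x)).
  move=> /andP[s0 sh] /andP[t0 th]; rewrite -ball_normE/= addrA -[X in `|X|]opprB.
  rewrite normrN addrK (le_lt_trans (ler_normD _ _))// !normrZ !ger0_norm//.
  have -> : d = h * (`|u| + `|v| + 1) by rewrite divfK ?gt_eqF.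
  rewrite mulrDr mulr1 mulrDr ltr_pwDr// lerD// ler_wpM2r//.
have [s [t [/andP[s0 sh] /andP[t0 th] E1]]] := @second_difference f A x u v h
  oA fs h0 (fun s t hs ht => (dA _ (hball s t hs ht)).1.1).
have hball' s' t' : 0 <= s' <= h -> 0 <= t' <= h ->
    ball x d (s' *: v + (t' *: u + x)).
  by move=> hs ht; rewrite addrCA; exact: hball.
have [s' [t' [/andP[s'0 s'h] /andP[t'0 t'h] E2]]] := @second_difference f A x v u h
  oA fs h0 (fun s t hs ht => (dA _ (hball' s t hs ht)).1.1).
have EE : 'D_v ('D_u f) (s *: u + (t *: v + x)) =
    'D_u ('D_v f) (s' *: v + (t' *: u + x)).
  have hn0 : h != 0 by rewrite gt_eqF.
  apply: (mulIf hn0); apply: (mulIf hn0).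
  apply: etrans (esym E1) _; apply: etrans _ E2.
  rewrite (addrCA (h *: u)) !opprB !addrA.
  by rewrite [LHS]addrAC [RHS]addrAC [X in X + _ = _]addrAC.
have hs : 0 <= s <= h by rewrite !ltW.
have ht : 0 <= t <= h by rewrite !ltW.
have hs' : 0 <= s' <= h by rewrite !ltW.
have ht' : 0 <= t' <= h by rewrite !ltW.
have /= B1 := (dA _ (hball _ _ hs ht)).2.
have /= B2 := (dA _ (hball' _ _ hs' ht')).1.2.
have dist_le (a b c : R) : `|a - c| < e / 2 -> `|b - c| < e / 2 -> `|a - b| <= e.
  clear; move=> ac bc; rewrite -(subrKA c) (le_trans (ler_normD _ _))//.
  by rewrite [e]splitr lerD ?ltW// distrC.
by apply: dist_le B2 _; rewrite -EE.
Qed.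

End mixed_derivatives.

(** * Bump functions *)

Section bump.
Context {R : realType}.

(** The factor t^-k makes the family closed under differentiation up to linear combinations, so that
    smoothness for k = 0, the usual e^(-1/t), follows by induction. *)
Definition flat_exp (k : nat) (t : R) : R :=
  if 0 < t then t^-1 ^+ k * expR (- t^-1) else 0.

(** With s = 1/t the exponential series gives e^s >= s^(k+2)/(k+2)!; the order k + 2 leaves a factor
    t^2, which is what makes the derivative at 0 vanish. *)
Lemma flat_exp_le (k : nat) (t : R) :
  `|flat_exp k t| <= k.+2`!%:R * t ^+ 2.
Proof.
rewrite /flat_exp; case: ifPn => [t0|_]; last first.
  by rewrite normr0 mulr_ge0 ?sqr_ge0.
have s0 : 0 < t^-1 by rewrite invr_gt0.
rewrite ger0_norm; last by rewrite mulr_ge0 ?expR_ge0 ?exprn_ge0 ?ltW.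
rewrite expRN ler_pdivrMr ?expR_gt0//.
have fac0 : 0 < k.+2`!%:R :> R by rewrite ltr0n fact_gt0.
have := expR_ge1Dxn k.+1 (ltW s0); rewrite -lerBrDl => eB.
have {}eB : t^-1 ^+ k.+2 / k.+2`!%:R <= expR t^-1.
  by rewrite (le_trans eB)// gerBl.
move: eB; rewrite ler_pdivrMr// => eB.
rewrite mulrAC [X in X * _]mulrC -ler_pdivrMr ?exprn_gt0// -exprVn.
by rewrite -exprD addn2.
Qed.

Lemma flat_exp_is_derive (k : nat) (t : R) :
  is_derive t 1 (flat_exp k) (flat_exp k.+2 t - k%:R * flat_exp k.+1 t).
Proof.
have [t0|t0|<-] := ltgtP 0 t.
- have fE : \near t, t^-1 ^+ k * expR (- t^-1) = flat_exp k t.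
    near=> s; rewrite /flat_exp ifT//; near: s; exact: lt_nbhsr.
  apply: near_eq_is_derive fE _; rewrite /flat_exp t0.
  have tn0 : t != 0 by rewrite gt_eqF.
  have dV : is_derive t 1 (fun s : R => s^-1) (- t ^- 2).
    have di := @derivable_id R R t 1.
    apply: DeriveDef; first exact: (derivableV (f := id)).
    by rewrite (deriveV (f := id))// derive_id [_ *: _]mulr1.
  have dE : is_derive t 1 (fun s : R => expR (- s^-1)) (t ^- 2 * expR (- t^-1)).
    have := @is_derive1_comp _ expR (fun s : R => - s^-1) t _ _ _ (is_deriveN dV).
    by move=> /(_ _ (is_derive_expR _)); rewrite opprK mulrC.
  have dX := @is_deriveX _ _ (fun s : R => s^-1) k t 1 _ dV.
  have := is_deriveM dX dE.
  set f := (X in is_derive _ _ X _ -> _); set a := (X in is_derive _ _ _ X -> _).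
  set g := (X in _ -> is_derive _ _ X _); set b := (X in _ -> is_derive _ _ _ X).
  have -> : f = g.
    by apply/funext => s; rewrite /f /g/= /GRing.mul/= exprfctE.
  suff -> : a = b by [].
  rewrite /a /b exprfctE/= -!exprVn; move: (t^-1) (expR _) => s e.
  case: k {f a g b dX} => [|k]; rewrite /GRing.scale/=; first by ring.
  by rewrite !exprS; ring.
- have fE : \near t, 0 = flat_exp k t.
    near=> s; rewrite /flat_exp ltNge (_ : s <= 0)//; apply: ltW.
    by near: s; exact: lt_nbhsl.
  apply: near_eq_is_derive fE _.
  by rewrite /flat_exp ltNge (ltW t0)/= mulr0 subr0; exact: is_derive_cst.
(* At t = 0 the difference quotient is at most (k+2)! |h| by the quadratic bound. *)
rewrite /flat_exp ltxx mulr0 subr0 -/(flat_exp k).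
have : (fun h : R => h^-1 *: (flat_exp k (h *: 1 + 0) - flat_exp k 0)) @ 0^' --> (0 : R).
  apply/cvgrPdist_le => e e0; near=> h.
  have h0 : h != 0 by near: h; exact: nbhs_dnbhs_neq.
  rewrite sub0r normrN {2}/flat_exp ltxx subr0 addr0 [_ *: _]mulrC normrM normfV.
  rewrite ler_pdivrMr ?normr_gt0// [h *: 1]mulr1 (le_trans (flat_exp_le _ _))//.
  rewrite -(real_normK (num_real h)) expr2 mulrA ler_wpM2r//.
  rewrite -ler_pdivlMl ?ltr0n ?fact_gt0//.
  near: h; apply: dnbhs0_le.
  by rewrite mulr_gt0// invr_gt0 ltr0n fact_gt0.
move=> cv; apply: DeriveDef; first by apply/cvg_ex; exists 0.
exact: cvg_lim cv.
Unshelve. all: by end_near. Qed.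


Lemma smooth_on_flat_exp (V : normedModType R) (A : set V) (l : V -> R^o) :
  open A -> smooth_on A l ->
  smooth_on A (fun x => flat_exp 0 (l x) : R^o).
Proof.
(* The index has to vary in the induction, as one derivative turns k into k+1 and k+2. *)
move=> oA /smooth_onP ls; apply/smooth_onP => m; move: 0%N => k.
elim: m k => //= m IH k; split=> [x Ax|u].
  apply: (@differentiable_comp _ _ _ _ l (flat_exp k : R -> R^o)).
    by case: (ls 1) => + _; exact.
  by apply/derivable1_diffP; have [] := flat_exp_is_derive k (l x).
have ck1 c : ck A m (fun x => c * flat_exp k.+1 (l x) : R^o).
  exact: (ckM oA (ck_cst oA m (c : R^o)) (IH k.+1)).
apply: (ck_ext oA) (ckM oA (ckD oA (IH k.+2) (ck1 (- k%:R))) ((ls m.+1).2 u)).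
move=> x Ax; have dl : differentiable l x by case: (ls 1) => + _; exact.
have := flat_exp_is_derive k (l x); set d := (X in is_derive _ _ _ X) => dk.
have dflat : differentiable (flat_exp k : R -> R^o) (l x).
  by apply/derivable1_diffP; case: dk.
rewrite [RHS]deriveE; last exact: (differentiable_comp dl dflat).
rewrite (diff_comp dl dflat)/= -(deriveE u dl).
rewrite -[X in 'd _ _ X]mulr1 [RHS]linearZ/= -(deriveE _ dflat) derive_val.
by rewrite mulNr [RHS]mulrC.
Qed.

Lemma smooth_on_prod (V : normedModType R) (A : set V) (I : Type) (r : seq I)
    (f : I -> V -> R^o) : open A -> (forall i, smooth_on A (f i)) ->
  smooth_on A (fun x => \prod_(i <- r) f i x : R^o).
Proof.
move=> oA fs; elim: r => [|i r IH].
  apply: (smooth_on_ext oA) (smooth_on_cst _ oA) => x _.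
  by rewrite big_nil.
apply: (smooth_on_ext oA) (smooth_onM oA (fs i) IH) => x _.
by rewrite big_cons.
Qed.

Lemma flat_exp_gt0 (t : R) : (0 < flat_exp 0 t) = (0 < t).
Proof.
by rewrite /flat_exp; case: ifP => _; rewrite ?ltxx// expr0 mul1r expR_gt0.
Qed.

Lemma flat_exp_neq0 (t : R) : flat_exp 0 t != 0 -> 0 < t.
Proof. by rewrite /flat_exp; case: ifP => //; rewrite eqxx. Qed.

Lemma bump_rV (n : nat) (a : 'rV[R]_n) (r : R) : 0 < r ->
  exists b : 'rV[R]_n -> R^o, [/\ smooth_on setT b, b a = 1 &
    forall x, b x != 0 -> `|a - x| <= r].
Proof.
move=> r0.
(* The j-th factor is nonzero exactly when |x_j - a_j| < r, and the norm of a row vector is its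
   largest absolute entry. *)
pose f (x : 'rV[R]_n) : R^o := \prod_(j < n)
  (flat_exp 0 (r - a 0 j + x 0 j) * flat_exp 0 (r + a 0 j + (-1) * x 0 j)).
have fs : smooth_on setT f.
  apply: smooth_on_prod => [|j]; first exact: openT.
  have xs : smooth_on setT (fun x : 'rV[R]_n => x 0 j : R^o).
    have /smooth_on_mxP := smooth_on_id (@openT 'rV[R]_n).
    by move=> /(_ openT 0 j).
  have cs (c : R^o) : smooth_on setT (fun=> c : R^o).
    exact: (smooth_on_cst _ openT).
  apply: smooth_onM; first exact: openT.
    apply: smooth_on_flat_exp; first exact: openT.
    by apply: smooth_onD xs; [exact: openT|exact: cs].
  apply: smooth_on_flat_exp; first exact: openT.
  apply: smooth_onD; [exact: openT|exact: cs|].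
  by apply: smooth_onM xs; [exact: openT|exact: cs].
have fa : f a != 0.
  apply/prodf_neq0 => j _; rewrite mulf_neq0// gt_eqF// flat_exp_gt0.
    by rewrite subrK.
  by rewrite mulN1r addrK.
exists (fun x => (f a)^-1 * f x); split.
- by apply: smooth_onM fs; [|apply: smooth_on_cst]; exact: openT.
- by rewrite mulVf.
- move=> x; rewrite mulf_eq0 negb_or => /andP[_ /prodf_neq0 fx].
  rewrite {1}/Num.Def.normr/= mx_normrE; apply: bigmax_le; first exact: ltW.
  move=> [i j] _; rewrite !mxE ord1/=.
  have := fx j isT; rewrite mulf_eq0 negb_or => /andP[/flat_exp_neq0 h1 /flat_exp_neq0].
  rewrite mulN1r => h2; rewrite ler_norml lerBrDl; apply/andP; split; lra.
Qed.

End bump.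

(** * Charts and tangent vectors *)

(** A chart and its inverse cancel only on the chart domain and its image, so identities between
    compositions of charts hold near a point rather than everywhere. *)
Lemma near_diff_comp (R : realType) (U V W : normedModType R) (f : U -> V)
    (g : V -> W) (h : U -> W) x y :
  f x = y -> (\forall z \near x, g (f z) = h z) ->
  differentiable f x -> differentiable g y ->
  'd h x = 'd g y \o 'd f x :> (U -> W).
Proof.
move=> <- gfh df dg; rewrite -(diff_comp df dg).
exact: (near_eq_is_diff gfh (differentiable_comp df dg)).2.
Qed.

Section charts.
Context {R : realType} {m : nat} {M : manifold R m}.
Implicit Types (c d : chart R m M) (q : M).

Lemma chart_at_atlas q : atlas M (chart_at q).
Proof. by case: (svalP (cid (atlas_cover q))). Qed.

Lemma chart_at_dom q : chart_dom (chart_at q) q.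
Proof. by case: (svalP (cid (atlas_cover q))). Qed.

Lemma chartK c q : chart_dom c q -> chart_inv c (c q) = q.
Proof. by move=> cq; apply: (chart_mapK (c := c)); rewrite inE. Qed.

Lemma chart_inv_continuous_at c q :
  chart_dom c q -> {for c q, continuous (chart_inv c)}.
Proof.
move=> cq; have := chart_inv_continuous (c := c).
rewrite continuous_open_subspace; last exact: chart_img_open.
by apply; rewrite inE; exists q.
Qed.

Lemma chart_inv_near c q (P : set M) : chart_dom c q -> nbhs q P ->
  \forall u \near c q, P (chart_inv c u).
Proof.
move=> cq qP; have := chart_inv_continuous_at cq.
by rewrite /prop_for /continuous_at chartK//; apply.
Qed.

Lemma chart_img_nbhs c q (U : set M) : chart_dom c q -> nbhs q U ->
  nbhs (c q) (c @` (chart_dom c `&` U)).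
Proof.
move=> cq qU; have iU := chart_inv_near cq qU.
have iD : nbhs (c q) (c @` chart_dom c).
  by apply: open_nbhs_nbhs; split; [exact: chart_img_open|exists q].
apply: filterS2 iU iD => u Uu [q' cq' q'u]; exists q' => //.
by split=> //; rewrite -(chartK cq') q'u.
Qed.

Lemma chart_imgI_open c (U : set M) :
  open U -> open (c @` (chart_dom c `&` U)).
Proof.
move=> oU; rewrite openE => _ [q [cq Uq] <-]; apply: chart_img_nbhs => //.
exact: open_nbhs_nbhs.
Qed.

Lemma transition_differentiable c d q : atlas M c -> atlas M d ->
  chart_dom c q -> chart_dom d q ->
  differentiable (d \o chart_inv c) (c q).
Proof.
move=> Mc Md cq dq; apply: (smooth_on_differentiable (atlas_smooth Mc Md)).
by exists q.
Qed.

Lemma diff_chart_change (W : normedModType R) (G : M -> W) c c0 q :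
  atlas M c -> atlas M c0 -> chart_dom c q -> chart_dom c0 q ->
  differentiable (G \o chart_inv c) (c q) ->
  forall v, 'd (G \o chart_inv c0) (c0 q) v =
    'd (G \o chart_inv c) (c q) ('d (c \o chart_inv c0) (c0 q) v).
Proof.
move=> Mc Mc0 cq c0q dG; apply/funeqP.
have dt := transition_differentiable Mc0 Mc c0q cq.
apply: near_diff_comp dt dG; first by rewrite /= chartK.
have : nbhs q (chart_dom c).
  by apply: open_nbhs_nbhs; split=> //; exact: chart_dom_open.
by move/(chart_inv_near c0q); apply: filterS => u cu; rewrite /= chartK.
Qed.

Lemma coordsD c q (v w : tangent q) : coords c (v + w) = coords c v + coords c w.
Proof. exact: linearD. Qed.

Lemma coordsZ c q (a : R) (v : tangent q) : coords c (a *: v) = a *: coords c v.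
Proof. exact: linearZ. Qed.

Lemma coords_change c d q (v : tangent q) : atlas M c -> atlas M d ->
  chart_dom c q -> chart_dom d q ->
  coords d v = 'd (d \o chart_inv c) (c q) (coords c v).
Proof.
move=> Mc Md cq dq; apply: diff_chart_change => //.
- exact: chart_at_atlas.
- exact: chart_at_dom.
- exact: transition_differentiable.
Qed.

Lemma coords_chart_at q (v : tangent q) : coords (chart_at q) v = v.
Proof.
rewrite /coords.
have E : \forall u \near chart_at q q, id u = (chart_at q \o chart_inv (chart_at q)) u.
  have : nbhs (chart_at q q) (chart_at q @` chart_dom (chart_at q)).
    apply: open_nbhs_nbhs; split; first exact: chart_img_open.
    by exists q => //; exact: chart_at_dom.
  by apply: filterS => _ [q' q'D <-]; rewrite /= chartK.
have [_ /funeqP dE] := near_eq_is_diff E (is_diff_id _).(ex_diff).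
by apply: (etrans (dE v)); rewrite diff_val.
Qed.

(** Inverse of [coords c] at q: components in c are carried over to the chart in which [tangent q]
    stores its vectors. For fixed e and varying q this is the field with constant components e in
    c. *)
Definition of_coords c q (e : 'rV[R]_m) : tangent q :=
  'd (chart_at q \o chart_inv c) (c q) e.

Lemma coordsK c q (v : tangent q) : atlas M c -> chart_dom c q ->
  of_coords c q (coords c v) = v.
Proof.
move=> Mc cq; rewrite /of_coords -coords_change ?coords_chart_at//.
  exact: chart_at_atlas.
exact: chart_at_dom.
Qed.

Lemma coords_of_coords c d q e : atlas M c -> atlas M d ->
  chart_dom c q -> chart_dom d q ->
  coords d (of_coords c q e) = 'd (d \o chart_inv c) (c q) e.
Proof.
move=> Mc Md cq dq; have Mq := chart_at_atlas q; have qq := chart_at_dom q.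
apply/esym/diff_chart_change => //; exact: transition_differentiable.
Qed.

Lemma smooth_fun_differentiable (f : M -> R) c q : smooth_fun f ->
  atlas M c -> chart_dom c q ->
  differentiable ((f : M -> R^o) \o chart_inv c) (c q).
Proof.
by move=> fs Mc cq; apply: (smooth_on_differentiable (fs c Mc)); exists q.
Qed.

Lemma tderivE (f : M -> R) c q (v : tangent q) : smooth_fun f ->
  atlas M c -> chart_dom c q ->
  tderiv v f = 'd ((f : M -> R^o) \o chart_inv c) (c q) (coords c v).
Proof.
move=> fs Mc cq; apply: diff_chart_change => //.
- exact: chart_at_atlas.
- exact: chart_at_dom.
- exact: smooth_fun_differentiable.
Qed.

Lemma tderivDl q (v w : tangent q) (f : M -> R) :
  tderiv (v + w) f = tderiv v f + tderiv w f.
Proof. exact: linearD. Qed.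

Lemma tderivZl q (a : R) (v : tangent q) (f : M -> R) :
  tderiv (a *: v) f = a * tderiv v f.
Proof. exact: linearZ. Qed.

Lemma smooth_fun_local (f : M -> R) :
  (forall q, exists (U : set M) (g : M -> R), [/\ open U, U q,
     forall y, U y -> g y = f y &
     forall c, atlas M c ->
       smooth_on (c @` (chart_dom c `&` U)) ((g : M -> R^o) \o chart_inv c)]) ->
  smooth_fun f.
Proof.
move=> loc c Mc; apply: smooth_on_local => _ [q cq <-].
have [U [g [oU Uq gf gs]]] := loc q.
exists (c @` (chart_dom c `&` U)), ((g : M -> R^o) \o chart_inv c); split.
- exact: chart_imgI_open.
- by exists q.
- by move=> _ [q' [cq' Uq'] <-]; rewrite /= chartK// gf.
- exact: gs.
Qed.

Lemma smooth_fun_cst (a : R) : smooth_fun (fun _ : M => a).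
Proof. by move=> c _; apply: smooth_on_cst; exact: chart_img_open. Qed.

Lemma smooth_funM (f g : M -> R) :
  smooth_fun f -> smooth_fun g -> smooth_fun (fun q => f q * g q).
Proof.
move=> fs gs c Mc; apply: smooth_onM (fs c Mc) (gs c Mc).
exact: chart_img_open.
Qed.

Lemma smooth_fun_sum (I : Type) (r : seq I) (f : I -> M -> R) :
  (forall j, smooth_fun (f j)) -> smooth_fun (fun q => \sum_(j <- r) f j q).
Proof.
move=> fs c Mc; apply: (smooth_on_sum r (f := fun j => (f j : M -> R^o) \o _)).
  exact: chart_img_open.
by move=> j; exact: fs.
Qed.

Lemma tderivDr q (v : tangent q) (f g : M -> R) :
  smooth_fun f -> smooth_fun g ->
  tderiv v (fun q => f q + g q) = tderiv v f + tderiv v g.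
Proof.
move=> fs gs; rewrite /tderiv; have Mc := chart_at_atlas q.
have cq := chart_at_dom q.
have df := smooth_fun_differentiable fs Mc cq.
have dg := smooth_fun_differentiable gs Mc cq.
by rewrite -[RHS]/(('d _ _ \+ 'd _ _) v) -diffD.
Qed.

Lemma tderivM q (v : tangent q) (f g : M -> R) :
  smooth_fun f -> smooth_fun g ->
  tderiv v (fun q => f q * g q) = f q * tderiv v g + g q * tderiv v f.
Proof.
move=> fs gs; have Mc := chart_at_atlas q.
have cq := chart_at_dom q.
have df := smooth_fun_differentiable fs Mc cq.
have dg := smooth_fun_differentiable gs Mc cq.
have /funeqP/(_ v) dM := diffM df dg.
apply: (etrans dM).
rewrite -[LHS]/(f (chart_inv (chart_at q) (chart_at q q)) * tderiv v g +
  g (chart_inv (chart_at q) (chart_at q q)) * tderiv v f).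
by rewrite chartK.
Qed.

Lemma tderiv_cst q (v : tangent q) (a : R) : tderiv v (fun _ : M => a) = 0.
Proof.
have /funeqP := @diff_cst R 'rV[R]_m R^o a (chart_at q q).
exact.
Qed.

Lemma tderiv_sum q (v : tangent q) (I : Type) (r : seq I) (f : I -> M -> R) :
  (forall j, smooth_fun (f j)) ->
  tderiv v (fun q => \sum_(j <- r) f j q) = \sum_(j <- r) tderiv v (f j).
Proof.
move=> fs; elim: r => [|j r IH].
  rewrite big_nil -[RHS](tderiv_cst v 0).
  by congr tderiv; apply/funext => ?; rewrite big_nil.
rewrite big_cons -IH.
apply: etrans (tderivDr v (fs j) (smooth_fun_sum r fs)).
by congr tderiv; apply/funext => ?; rewrite big_cons.
Qed.

End charts.

(** * Sections along a map *)

Section fields_along_a_map.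
Context {R : realType} {m n : nat} {M : manifold R m} {N : manifold R n}.
Variable i : M -> N.
Hypothesis hi : smooth_map i.

Lemma preimage_chart_open (U : set N) : open U -> open (i @^-1` U).
Proof. by move=> oU; apply: open_comp => // x _; exact: hi.1. Qed.

Lemma chart_dom_along_open (c : chart R m M) (d : chart R n N) :
  open (c @` (chart_dom c `&` i @^-1` chart_dom d)).
Proof. exact/chart_imgI_open/preimage_chart_open/chart_dom_open. Qed.

Lemma smooth_map_chart (c : chart R m M) (d : chart R n N) :
  atlas M c -> atlas N d ->
  smooth_on (c @` (chart_dom c `&` i @^-1` chart_dom d))
    (d \o i \o chart_inv c).
Proof. by case: hi => _; exact. Qed.

Lemma smooth_map_differentiable (c : chart R m M) (d : chart R n N) x :
  atlas M c -> atlas N d -> chart_dom c x -> chart_dom d (i x) ->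
  differentiable (d \o i \o chart_inv c) (c x).
Proof.
move=> Mc Nd cx dx; apply: (smooth_on_differentiable (smooth_map_chart Mc Nd)).
by exists x.
Qed.

Lemma diff_comp_along (W : normedModType R) (G : N -> W) (c : chart R m M)
    (d : chart R n N) x :
  atlas M c -> atlas N d -> chart_dom c x -> chart_dom d (i x) ->
  differentiable (G \o chart_inv d) (d (i x)) ->
  forall v, 'd (G \o i \o chart_inv c) (c x) v =
    'd (G \o chart_inv d) (d (i x)) ('d (d \o i \o chart_inv c) (c x) v).
Proof.
move=> Mc Nd cx dx dG; apply/funeqP; have di := smooth_map_differentiable Mc Nd cx dx.
apply: near_diff_comp di dG; first by rewrite /= chartK.
have : nbhs x (i @^-1` chart_dom d).
  by apply: open_nbhs_nbhs; split=> //; exact/preimage_chart_open/chart_dom_open.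
by move/(chart_inv_near cx); apply: filterS => u du; rewrite /= chartK.
Qed.

Lemma coords_differential (c : chart R m M) (d : chart R n N) x
    (v : tangent x) :
  atlas M c -> atlas N d -> chart_dom c x -> chart_dom d (i x) ->
  coords d (differential i x v) = 'd (d \o i \o chart_inv c) (c x) (coords c v).
Proof.
move=> Mc Nd cx dx; have Mx := chart_at_atlas x; have xx := chart_at_dom x.
have Nx := chart_at_atlas (i x); have ixx := chart_at_dom (i x).
have dt := transition_differentiable Nx Nd ixx dx.
apply: (etrans (esym (diff_comp_along Mx Nx xx ixx dt v))).
exact: (diff_chart_change Mc Mx cx xx (smooth_map_differentiable Mc Nd cx dx)).
Qed.

Lemma tderiv_differential x (v : tangent x) (h : N -> R) : smooth_fun h ->
  tderiv (differential i x v) h = tderiv v (h \o i).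
Proof.
move=> hs.
have Mx := chart_at_atlas x; have xx := chart_at_dom x.
have Nx := chart_at_atlas (i x); have ixx := chart_at_dom (i x).
have dh := smooth_fun_differentiable hs Nx ixx.
exact/esym/(diff_comp_along Mx Nx xx ixx dh).
Qed.

Lemma smooth_fun_comp (h : N -> R) : smooth_fun h -> smooth_fun (h \o i).
Proof.
move=> hs; apply: smooth_fun_local => x.
pose d := chart_at (i x); have Nd : atlas N d := chart_at_atlas _.
exists (i @^-1` chart_dom d), (h \o i); split=> //.
- exact/preimage_chart_open/chart_dom_open.
- exact: chart_at_dom.
move=> c Mc; have oA := @chart_dom_along_open c d.
have oB := @chart_img_open _ _ _ d.
apply: (smooth_on_ext oA _ (smooth_on_comp oA oB _ (smooth_map_chart Mc Nd) (hs d Nd))).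
  by move=> _ [y [cy dy] <-]; rewrite /= !chartK.
by move=> _ [y [cy dy] <-]; rewrite /= !chartK//; exists (i y).
Qed.

Lemma smooth_alongD (V W : vfield_along i) : smooth_along V -> smooth_along W ->
  smooth_along (fun x => V x + W x : tangent (i x)).
Proof.
move=> Vs Ws c d Mc Nd; have oA := @chart_dom_along_open c d.
apply: (smooth_on_ext oA _ (smooth_onD oA (Vs c d Mc Nd) (Ws c d Mc Nd))).
by move=> u _; rewrite coordsD.
Qed.

Lemma smooth_alongZ (f : M -> R) (V : vfield_along i) :
  smooth_fun f -> smooth_along V ->
  smooth_along (fun x => f x *: V x : tangent (i x)).
Proof.
move=> fs Vs c d Mc Nd; have oA := @chart_dom_along_open c d.
have fs' : smooth_on (c @` (chart_dom c `&` i @^-1` chart_dom d))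
    ((f : M -> R^o) \o chart_inv c).
  by apply: smooth_on_subset (fs c Mc) => _ [x [cx _] <-]; exists x.
apply: (smooth_on_ext oA _ (smooth_onZ oA fs' (Vs c d Mc Nd))).
by move=> u _; rewrite coordsZ.
Qed.

Lemma smooth_along0 : smooth_along (fun x => 0 : tangent (i x)).
Proof.
move=> c d Mc Nd; have oA := @chart_dom_along_open c d.
apply: (smooth_on_ext oA _ (smooth_on_cst 0 oA)) => u _.
exact/esym/linear0.
Qed.

Lemma smooth_along_sum (I : Type) (r : seq I) (V : I -> vfield_along i) :
  (forall j, smooth_along (V j)) ->
  smooth_along (fun x => \sum_(j <- r) V j x : tangent (i x)).
Proof.
move=> Vs; elim: r => [|j r IH].
  rewrite (_ : (fun _ => _) = (fun x => 0 : tangent (i x))).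
    exact: smooth_along0.
  by apply/functional_extensionality_dep => x; rewrite big_nil.
rewrite (_ : (fun _ => _) =
  (fun x => V j x + \sum_(k <- r) V k x : tangent (i x))).
  exact: smooth_alongD.
by apply/functional_extensionality_dep => x; rewrite big_cons.
Qed.

Lemma smooth_along_comp (Y : vfield N) : smooth_vfield Y ->
  smooth_along (fun x => Y (i x) : tangent (i x)).
Proof.
move=> Ys c d Mc Nd; have oA := @chart_dom_along_open c d.
have oB := @chart_imgI_open _ _ _ d _ (@chart_dom_open _ _ _ d).
apply: (smooth_on_ext oA _
  (smooth_on_comp_mx oA oB _ (smooth_map_chart Mc Nd) (Ys d d Nd Nd))).
  by move=> _ [y [cy dy] <-]; rewrite /= !chartK.
by move=> _ [y [cy dy] <-]; rewrite /= !chartK//; exists (i y).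
Qed.

Lemma smooth_along_tderiv (V : vfield_along i) (h : N -> R) :
  smooth_along V -> smooth_fun h -> smooth_fun (fun x => tderiv (V x) h).
Proof.
move=> Vs hs; apply: smooth_fun_local => x.
pose d := chart_at (i x); have Nd : atlas N d := chart_at_atlas _.
exists (i @^-1` chart_dom d), (fun x => tderiv (V x) h); split=> //.
- exact/preimage_chart_open/chart_dom_open.
- exact: chart_at_dom.
move=> c Mc; have oA := @chart_dom_along_open c d.
have oB := @chart_img_open _ _ _ d.
apply: (smooth_on_ext oA _
  (smooth_on_diff oA oB _ (smooth_map_chart Mc Nd) (Vs c d Mc Nd) (hs d Nd))).
  by move=> _ [y [cy dy] <-]; rewrite /= !chartK// (tderivE _ hs Nd dy).
by move=> _ [y [cy dy] <-]; rewrite /= !chartK//; exists (i y).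
Qed.

End fields_along_a_map.

Lemma smooth_map_id (R : realType) (m : nat) (M : manifold R m) :
  smooth_map (idfun : M -> M).
Proof. by split=> [x //|c d Mc Md]; exact: atlas_smooth. Qed.

Lemma smooth_pushforward (R : realType) (m n : nat) (M : manifold R m)
    (N : manifold R n) (i : M -> N) (X : vfield M) :
  smooth_map i -> smooth_vfield X -> smooth_along (Defs.pushforward i X).
Proof.
move=> hi Xs c d Mc Nd; have oA := @chart_dom_along_open _ _ _ _ _ _ hi c d.
have Xs' : smooth_on (c @` (chart_dom c `&` i @^-1` chart_dom d))
    (fun u => coords c (X (chart_inv c u))).
  by apply: smooth_on_subset (Xs c c Mc Mc) => _ [x [cx _] <-]; exists x.
apply: (smooth_on_ext oA _ (smooth_on_diff_mx oA oA _
  (smooth_on_id oA) Xs' (smooth_map_chart hi Mc Nd))) => //.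
move=> _ [y [cy dy] <-]; rewrite /Defs.pushforward /= chartK//.
by rewrite (coords_differential hi _ Mc Nd).
Qed.

(** * Cut-off functions and local frames *)

(** A bump in the chart is extended by 0. It vanishes outside the image S of a compact ball, and S
    is closed because the manifold is Hausdorff; hence the chart domain and the complement of S are
    open, cover the manifold, and smoothness is clear on each. *)
Lemma manifold_bump (R : realType) (n : nat) (N : manifold R n) (p : N) :
  exists (chi : N -> R) (S : set N), [/\ smooth_fun chi, chi p = 1, closed S,
    S `<=` chart_dom (chart_at p) & forall q, ~ S q -> chi q = 0].
Proof.
set d := chart_at p; have Nd : atlas N d := chart_at_atlas p.
have dp : chart_dom d p := chart_at_dom p.
have : nbhs (d p) (d @` chart_dom d).
  by apply: open_nbhs_nbhs; split; [exact: chart_img_open|exists p].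
move=> /nbhs_ballP[e /= e0 de].
(* Half the radius keeps the closed ball inside the open ball of radius e, which lies in the image
   of the chart. *)
have e20 : 0 < e / 2 by rewrite divr_gt0.
have [b [bs b1 b0]] := bump_rV (d p) e20.
pose K := closed_ball (d p) (e / 2).
have KE : K = [set u | `|d p - u| <= e / 2] by rewrite /K closed_ballE.
have Kd : K `<=` d @` chart_dom d.
  move=> u; rewrite KE/= => ue; apply: de; rewrite -ball_normE/=.
  by rewrite (le_lt_trans ue)// gtr_pMr// invf_lt1// ltr1n.
have cK : compact K.
  apply: bounded_closed_compact; last exact: closed_ball_closed.
  exists (`|d p| + e / 2); split; first exact: num_real.
  move=> M eM u; rewrite KE/= => ue; apply: ltW; apply: le_lt_trans eM.
  rewrite -[u in X in X <= _](subKr (d p)) (le_trans (ler_normB _ _))//.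
  by rewrite lerD2l.
pose S := chart_inv d @` K.
have cS : closed S.
  apply: compact_closed; first exact: manifold_hausdorff.
  apply: continuous_compact cK.
  exact: continuous_subspaceW Kd (chart_inv_continuous (c := d)).
have Sd : S `<=` chart_dom d.
  by move=> _ [u /Kd[q dq <-] <-]; rewrite chartK.
pose chi q := if `[< chart_dom d q >] then b (d q) else 0 : R.
have chi0 q : ~ S q -> chi q = 0.
  rewrite /chi; case: asboolP => // dq nSq; apply/eqP/negPn/negP => bq.
  by apply: nSq; exists (d q); [rewrite KE; exact: b0|rewrite chartK].
exists chi, S; split=> //; last by rewrite /chi asboolT.
apply: smooth_fun_local => q; have [dq|ndq] := pselect (chart_dom d q).
  exists (chart_dom d), (b \o d : N -> R); split=> //.
  - exact: chart_dom_open.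
  - by move=> y dy; rewrite /chi asboolT.
  move=> c Nc; have oA : open (c @` (chart_dom c `&` chart_dom d)).
    exact/chart_imgI_open/chart_dom_open.
  exact: (smooth_on_comp oA openT _ (atlas_smooth Nc Nd) bs).
exists (~` S), (fun=> 0); split=> //.
- exact: closed_openC.
- by move=> /Sd.
- by move=> y nSy; rewrite chi0.
- move=> c Nc; apply: smooth_on_cst; exact/chart_imgI_open/closed_openC.
Qed.

Lemma smooth_fun_cutoff (R : realType) (m : nat) (M : manifold R m)
    (f chi : M -> R) (S U : set M) :
  smooth_fun chi -> closed S -> open U -> S `<=` U ->
  (forall x, ~ S x -> chi x = 0) ->
  (forall c, atlas M c ->
    smooth_on (c @` (chart_dom c `&` U)) ((f : M -> R^o) \o chart_inv c)) ->
  smooth_fun (fun x => chi x * f x).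
Proof.
move=> chis cS oU SU chi0 fs; apply: smooth_fun_local => x.
have [Ux|nUx] := pselect (U x).
  exists U, (fun x => chi x * f x); split=> // c Mc.
  have oA := chart_imgI_open (c := c) oU.
  apply: (smooth_onM oA _ (fs c Mc)).
  by apply: smooth_on_subset (chis c Mc) => _ [y [cy _] <-]; exists y.
exists (~` S), (fun=> 0); split=> //.
- exact: closed_openC.
- by move=> /SU.
- by move=> y nSy; rewrite chi0// mul0r.
- move=> c Mc; apply: smooth_on_cst; exact/chart_imgI_open/closed_openC.
Qed.

(** [of_coords d q e] is meaningless off the domain of d, where chi vanishes. On that domain its
    components in another chart are the differential of the transition map applied to e, hence
    smooth. *)
Lemma smooth_coordinate_field (R : realType) (n : nat) (N : manifold R n)
    (chi : N -> R) (S : set N) (d : chart R n N) (e : 'rV[R]_n) :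
  smooth_fun chi -> closed S -> atlas N d -> S `<=` chart_dom d ->
  (forall q, ~ S q -> chi q = 0) ->
  smooth_vfield (fun q => chi q *: of_coords d q e : tangent q).
Proof.
move=> chis cS Nd Sd chi0 c d' Nc Nd'.
apply: smooth_on_local => _ [q [cq d'q] <-].
have oA U : open U ->
    open (c @` (chart_dom c `&` (idfun @^-1` chart_dom d' `&` U))).
  by move=> oU; apply/chart_imgI_open/openI => //; exact: chart_dom_open.
have [dq|ndq] := pselect (chart_dom d q); last first.
  exists (c @` (chart_dom c `&` (idfun @^-1` chart_dom d' `&` ~` S))), (fun=> 0).
  split.
  - exact/oA/closed_openC.
  - by exists q => //; split=> //; split=> // /Sd.
  - move=> _ [y [cy [_ nSy]] <-]; rewrite chartK// chi0// scale0r.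
    exact/esym/linear0.
  - exact/smooth_on_cst/oA/closed_openC.
pose B := c @` (chart_dom c `&` (idfun @^-1` chart_dom d' `&` chart_dom d)).
have oB : open B := oA _ (@chart_dom_open _ _ _ d).
exists B, (fun u => chi (chart_inv c u) *:
  'd (d' \o chart_inv d) ((d \o chart_inv c) u) e).
split=> //; first by exists q.
  move=> _ [y [cy [d'y dy]] <-]; rewrite /= chartK// coordsZ.
  by rewrite coords_of_coords.
have oD : open (d @` (chart_dom d `&` chart_dom d')).
  exact/chart_imgI_open/chart_dom_open.
apply: (smooth_onZ oB).
  by apply: smooth_on_subset (chis c Nc) => _ [y [cy _] <-]; exists y.
apply: (smooth_on_diff_mx oB oD _ _ (smooth_on_cst e oB) (atlas_smooth Nd Nd')).
  by move=> _ [y [cy [d'y dy]] <-]; rewrite /= chartK//; exists y.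
apply: smooth_on_subset (atlas_smooth Nc Nd) => _ [y [cy [_ dy]] <-].
by exists y.
Qed.

(* Multiplied by f, every section along a map is a combination of global
   fields on the target, although the field E only is a frame near p. *)
Lemma local_frame (R : realType) (n : nat) (N : manifold R n) (p : N) :
  exists (E : 'I_n -> vfield N) (f : N -> R),
    [/\ forall j, smooth_vfield (E j), smooth_fun f, f p = 1 &
    forall (m : nat) (M : manifold R m) (i : M -> N) (V : vfield_along i),
      smooth_map i -> smooth_along V ->
      exists2 a : 'I_n -> M -> R, forall j, smooth_fun (a j) &
        forall x, f (i x) *: V x = \sum_j a j x *: E j (i x)].
Proof.
have [chi [S [chis chip cS Sd chi0]]] := manifold_bump p.
set d := chart_at p in Sd; have Nd : atlas N d := chart_at_atlas p.
(* One factor chi makes the coordinate fields global, the other makes the coefficients of V global;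
   together they give f = chi^2. *)
exists (fun j q => chi q *: of_coords d q (delta_mx 0 j)),
  (fun q => chi q * chi q); split.
- by move=> j; exact: smooth_coordinate_field cS Nd Sd chi0.
- exact: smooth_funM.
- by rewrite chip mulr1.
move=> m M i V hi Vs.
exists (fun j x => chi (i x) * coords d (V x) 0 j).
  move=> j; apply: (@smooth_fun_cutoff _ _ _ _ _ (i @^-1` S)
    (i @^-1` chart_dom d) (smooth_fun_comp hi chis)).
  - by apply: closed_comp => // x _; exact: hi.1.
  - exact/preimage_chart_open/chart_dom_open.
  - by move=> x /Sd.
  - by move=> x nSx /=; rewrite chi0.
  move=> c Mc; have oA := @chart_dom_along_open _ _ _ _ _ _ hi c d.
  by have /(smooth_on_mxP _ oA) := Vs c d Mc Nd; exact.
move=> x; have [Sx|nSx] := pselect (S (i x)); last first.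
  by rewrite chi0// mul0r scale0r big1// => j _; rewrite mul0r scale0r.
rewrite -[in LHS](coordsK (V x) Nd (Sd _ Sx)) [in LHS](row_sum_delta (coords d (V x))).
rewrite /of_coords linear_sum scaler_sumr; apply: eq_bigr => j _.
by rewrite linearZ/= !scalerA mulrAC.
Qed.

(** * Lie brackets *)

(** A product rule, with y(u) frozen in the first term. Coordinates produce the sum of the y_j(u)
    D_v D_j K; symmetry of second derivatives turns it into the differential of D_v K applied to
    y(u), where linearity collects the sum. *)
Lemma derive_diff_field (R : realType) (p : nat) (A : set 'rV[R]_p)
    (K : 'rV[R]_p -> R^o) (y : 'rV[R]_p -> 'rV[R]_p) (u v : 'rV[R]_p) :
  open A -> A u -> smooth_on A K -> smooth_on A y ->
  'D_v (fun z => 'd K z (y z) : R^o) u =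
    'D_v ('D_(y u) K) u + 'd K u ('D_v y u).
Proof.
move=> oA Au Ks ys; have dy := smooth_on_differentiable ys Au.
have dK z : A z -> differentiable K z by exact: smooth_on_differentiable.
have dDK w : differentiable ('D_w K) u.
  exact: smooth_on_differentiable (smooth_on_derive w Ks) Au.
have yj j : derivable (fun z => y z 0 j : R^o) u v.
  by have /derivable_mxP := @diff_derivable _ _ _ _ _ v dy; exact.
have Kj j : derivable ('D_(delta_mx 0 j) K) u v by exact/diff_derivable.
have sw w : 'D_v ('D_w K) u = 'D_w ('D_v K) u := derive_commute v w oA Au Ks.
have -> : 'D_v (fun z => 'd K z (y z) : R^o) u = 'D_v (\sum_j
    ((fun z => y z 0 j : R) * ('D_(delta_mx 0 j) K : _ -> R))) u.
  apply: (open_eq_derive _ oA) Au => z Az.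
  rewrite (diff_sum_delta _ (dK z Az)) fct_sumE; exact: eq_bigr.
rewrite derive_sum; last by move=> j; exact: derivableM.
under eq_bigr do rewrite deriveM//.
rewrite big_split/=; congr (_ + _).
  rewrite [RHS]sw [RHS](deriveE _ (dDK v)) (diff_sum_delta _ (dDK v)).
  by apply: eq_bigr => j _; rewrite -[in RHS]sw.
rewrite (diff_sum_delta _ (dK u Au)); apply: eq_bigr => j _.
by rewrite derive_mx ?mxE; [exact: mulrC|exact/diff_derivable].
Qed.

Section lie_bracket.
Context {R : realType} {m : nat} {M : manifold R m}.

(* The second derivatives of k cancel, and Z is the bracket [X, Y] at x. *)
Lemma lie_bracket_tangent (X Y : vfield M) (x : M) :
  smooth_vfield X -> smooth_vfield Y ->
  exists Z : tangent x, forall k : M -> R, smooth_fun k ->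
    tderiv (X x) (fun q => tderiv (Y q) k) -
    tderiv (Y x) (fun q => tderiv (X q) k) = tderiv Z k.
Proof.
move=> Xs Ys; pose c := chart_at x; have Mc : atlas M c := chart_at_atlas x.
have cx : chart_dom c x := chart_at_dom x.
pose A := c @` chart_dom c; have oA : open A := @chart_img_open _ _ _ c.
have Ax : A (c x) by exists x.
pose comp (W : vfield M) u := coords c (W (chart_inv c u)).
have comps W : smooth_vfield W -> smooth_on A (comp W).
  by move=> Ws; apply: smooth_on_subset (Ws c c Mc Mc) => _ [q cq <-]; exists q.
have key V W k : smooth_vfield V -> smooth_vfield W -> smooth_fun k ->
    tderiv (V x) (fun q => tderiv (W q) k) =
    'D_(comp V (c x)) ('D_(comp W (c x)) ((k : M -> R^o) \o chart_inv c)) (c x) +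
    'd ((k : M -> R^o) \o chart_inv c) (c x) ('D_(comp V (c x)) (comp W) (c x)).
  move=> Vs Ws ks; rewrite -(derive_diff_field _ oA Ax (ks c Mc) (comps W Ws)).
  have Wks := smooth_along_tderiv (smooth_map_id M) Ws ks.
  have -> : comp V (c x) = coords c (V x) by rewrite /comp chartK.
  apply: (etrans (tderivE (V x) Wks Mc cx)).
  apply: (etrans (esym (deriveE _ (smooth_fun_differentiable Wks Mc cx)))).
  apply: (open_eq_derive _ oA) Ax => _ [q cq <-]; rewrite /= /comp chartK//.
  exact: tderivE.
exists ('D_(comp X (c x)) (comp Y) (c x) - 'D_(comp Y (c x)) (comp X) (c x)).
move=> k ks; rewrite (key X Y k Xs Ys ks) (key Y X k Ys Xs ks).
rewrite (derive_commute _ _ oA Ax (ks c Mc)) opprD addrACA subrr add0r.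
exact/esym/linearB.
Qed.

(** The k-th component of v is its derivative of the k-th coordinate times a bump chi with chi(p) =
    1, up to a multiple of v(chi); that vanishes too, as chi is itself a smooth function. *)
Lemma tderiv_eq0 (p : M) (v : tangent p) :
  (forall h : M -> R, smooth_fun h -> tderiv v h = 0) -> v = 0.
Proof.
move=> v0; have [chi [S [chis chip cS Sd chi0]]] := manifold_bump p.
set d := chart_at p in Sd; have Md : atlas M d := chart_at_atlas p.
have dp : chart_dom d p := chart_at_dom p.
apply/rowP => k; rewrite [RHS]mxE.
pose h (q : M) := chi q * d q 0 k.
have hs : smooth_fun h.
  apply: (smooth_fun_cutoff chis cS (@chart_dom_open _ _ _ d) Sd chi0) => c Mc.
  have oB := @chart_imgI_open _ _ _ c _ (@chart_dom_open _ _ _ d).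
  by have /(smooth_on_mxP _ oB) := atlas_smooth Mc Md; exact.
have := v0 h hs.
rewrite /tderiv -/d => hv.
have dchi := smooth_fun_differentiable chis Md dp.
have dk : differentiable (fun u : 'rV[R]_m => u 0 k : R) (d p).
  exact: differentiable_coord.
have hE : \forall u \near d p,
    (((chi : M -> R^o) \o chart_inv d : _ -> R) *
      (fun u : 'rV[R]_m => u 0 k : R)) u = ((h : M -> R^o) \o chart_inv d) u.
  have : nbhs (d p) (d @` chart_dom d).
    by apply: open_nbhs_nbhs; split; [exact: chart_img_open|exists p].
  apply: filterS => _ [q dq <-].
  by rewrite /h /= -[LHS]/(chi (chart_inv d (d q)) * d q 0 k) chartK.
have [_ /funeqP/(_ v) dhE] := near_eq_is_diff hE (differentiableM dchi dk).
have /funeqP/(_ v) dM := diffM dchi dk.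
have := etrans (esym hv) (etrans dhE dM).
rewrite -[X in _ = X]/(chi (chart_inv d (d p)) *
    'd (fun u : 'rV[R]_m => u 0 k : R) (d p) v +
  d p 0 k * 'd ((chi : M -> R^o) \o chart_inv d) (d p) v).
rewrite chartK// chip mul1r -[X in _ + _ * X]/(tderiv v chi) v0// mulr0 addr0.
rewrite -deriveE// => ->.
have := @derive_mx R 'rV[R]_m 1 m id (d p) v (@derivable_id _ _ (d p) v).
by rewrite derive_id => {1}->; rewrite mxE.
Qed.

End lie_bracket.

(** * Pulled-back connections *)

Section connection_along.
Context {R : realType} {m n : nat} {M : manifold R m} {N : manifold R n}.
Variables (i : M -> N) (D : connection_along i).
Hypothesis hi : smooth_map i.

Lemma cov0 (X : vfield M) (x : M) : smooth_vfield X ->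
  D X (fun y => 0 : tangent (i y)) x = 0.
Proof.
move=> Xs; have s0 := smooth_along0 hi.
have := cov_addr D Xs s0 s0 x.
rewrite (_ : (fun y => 0 + 0 : tangent (i y)) = (fun y => 0 : tangent (i y))).
  by move/eqP; rewrite -subr_eq0 opprD addNKr oppr_eq0 => /eqP.
by apply/functional_extensionality_dep => y; rewrite addr0.
Qed.

Lemma cov_sum (X : vfield M) (I : Type) (r : seq I) (V : I -> vfield_along i)
    (x : M) : smooth_vfield X -> (forall j, smooth_along (V j)) ->
  D X (fun y => \sum_(j <- r) V j y : tangent (i y)) x =
  \sum_(j <- r) D X (V j) x.
Proof.
move=> Xs Vs; elim: r => [|j r IH].
  rewrite big_nil -[RHS](cov0 x Xs); congr (D X _ x).
  by apply/functional_extensionality_dep => y; rewrite big_nil.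
rewrite big_cons -IH.
apply: etrans (cov_addr D Xs (Vs j) (smooth_along_sum hi r Vs) x).
congr (D X _ x).
by apply/functional_extensionality_dep => y; rewrite big_cons.
Qed.

End connection_along.

Section pullback_connection.
Context {R : realType} {m n : nat} {M : manifold R m} {N : manifold R n}.
Variables (i : M -> N) (D : connection_along i) (nabla : connection N).
Hypothesis hi : smooth_map i.
Hypothesis hD : is_pullback_connection nabla D.

(** The pull-back hypothesis enters here: after Leibniz, each D_X (E_j o i) becomes a derivative by
    [nabla] along an ambient field X' with the right value at x. *)
Lemma cov_frame (X : vfield M) (X' : vfield N) (k : nat)
    (E : 'I_k -> vfield N) (a : 'I_k -> M -> R) (x : M) :
  smooth_vfield X -> smooth_vfield X' ->
  X' (i x) = differential i x (X x) ->
  (forall j, smooth_vfield (E j)) -> (forall j, smooth_fun (a j)) ->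
  D X (fun y => \sum_j a j y *: E j (i y) : tangent (i y)) x =
  \sum_j (tderiv (X x) (a j) *: E j (i x) + a j x *: nabla X' (E j) (i x)).
Proof.
move=> Xs X's X'E Es aS; have Eis j := smooth_along_comp hi (Es j).
rewrite (cov_sum D hi (index_enum _) (V := fun j y => a j y *: E j (i y)))//.
  apply: eq_bigr => j _; rewrite (cov_leibniz D (aS j) Xs (Eis j)).
  by rewrite (hD Xs X's (Es j) X'E).
by move=> j; exact: smooth_alongZ.
Qed.

(** The coefficients are frozen at x, so only the value there is matched; this is enough for the
    direction X' required by [is_pullback_connection]. *)
Lemma ambient_extension (V : vfield_along i) (x : M) : smooth_along V ->
  exists2 Y : vfield N, smooth_vfield Y & Y (i x) = V x.
Proof.
move=> Vs; have [E [f [Es fs fp exp]]] := local_frame (i x).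
have [a aS aE] := exp _ _ _ _ hi Vs.
exists (fun q => \sum_j a j x *: E j q : tangent q).
  apply: (smooth_along_sum (smooth_map_id N) (index_enum _)
    (V := fun j q => a j x *: E j q : tangent q)) => j.
  exact: (smooth_alongZ (smooth_map_id N) (smooth_fun_cst _) (Es j)).
by rewrite -aE fp scale1r.
Qed.

Lemma pullback_parallel (F : tensor11 N) (X : vfield M) (V : vfield_along i) :
  parallel11 nabla F -> smooth_vfield X -> smooth_along V ->
  smooth_along (fun y => F (i y) (V y) : tangent (i y)) ->
  forall x, D X (fun y => F (i y) (V y) : tangent (i y)) x =
    F (i x) (D X V x).
Proof.
move=> hF Xs Vs FVs x; have [E [f [Es fs fp exp]]] := local_frame (i x).
have [a aS aE] := exp _ _ _ _ hi Vs.
have [X' X's X'E] := ambient_extension x (smooth_pushforward hi Xs).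
have fis := smooth_fun_comp hi fs.
have FEs j : smooth_vfield (fun q => F q (E j q)) by exact: tensor11_smooth.
have E1 := cov_leibniz D fis Xs Vs x.
have E2 := cov_leibniz D fis Xs FVs x.
have E3 := cov_frame Xs X's X'E Es aS.
have E4 := cov_frame Xs X's X'E FEs aS.
have aE1 : (fun y => (f \o i) y *: V y : tangent (i y)) =
    (fun y => \sum_j a j y *: E j (i y)).
  by apply/functional_extensionality_dep.
have aE2 : (fun y => (f \o i) y *: F (i y) (V y) : tangent (i y)) =
    (fun y => \sum_j a j y *: F (i y) (E j (i y))).
  apply/functional_extensionality_dep => y; rewrite -linearZ/= aE linear_sum.
  by apply: eq_bigr => j _; rewrite linearZ.
rewrite aE1 E3 in E1; rewrite aE2 E4 in E2.
have := congr1 (F (i x)) E1; rewrite linearD !linearZ/= fp !scale1r => E1F.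
rewrite /= fp scale1r in E2.
(* Differentiating f V and f F(V) creates X(f) V and X(f) F(V); F maps the first to the second, so
   the traces of the cut-off cancel. *)
apply: (addrI (tderiv (X x) (f \o i) *: F (i x) (V x))).
rewrite -E2 -E1F linear_sum; apply: eq_bigr => j _.
rewrite linearD !linearZ/=; congr (_ + _ *: _).
by apply/eqP; rewrite -subr_eq0 (hF _ _ X's (Es j)).
Qed.

(* (nabla_X V) h - X (V h) is tensorial in X and V. *)
Lemma pullback_hessian (V : vfield_along i) (x : M) : smooth_along V ->
  exists Y : vfield N, [/\ smooth_vfield Y, Y (i x) = V x &
    forall (X : vfield M) (X' : vfield N) (h : N -> R),
      smooth_vfield X -> smooth_vfield X' ->
      X' (i x) = differential i x (X x) -> smooth_fun h ->
      tderiv (D X V x) h - tderiv (X x) (fun y => tderiv (V y) h) =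
      tderiv (nabla X' Y (i x)) h -
        tderiv (X' (i x)) (fun q => tderiv (Y q) h)].
Proof.
move=> Vs; have [E [f [Es fs fp exp]]] := local_frame (i x).
have [a aS aE] := exp _ _ _ _ hi Vs.
have hid := smooth_map_id N.
have cEs j : smooth_vfield (fun q => a j x *: E j q : tangent q).
  exact: (smooth_alongZ hid (smooth_fun_cst _) (Es j)).
exists (fun q => \sum_j a j x *: E j q : tangent q); split.
- exact: (smooth_along_sum hid (index_enum _) (V := fun j q => a j x *: E j q : tangent q)).
- by rewrite -aE fp scale1r.
move=> X X' h Xs X's X'E hs; have fis := smooth_fun_comp hi fs.
have VhS := smooth_along_tderiv hi Vs hs.
have EhS j := smooth_along_tderiv hid (Es j) hs.
have EhiS j := smooth_fun_comp hi (EhS j).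
have tderiv_lin z (v : tangent z) (b : 'I_n -> R) (w : 'I_n -> tangent z) :
    tderiv (\sum_j b j *: w j) h = \sum_j b j * tderiv (w j) h.
  by rewrite /tderiv linear_sum; apply: eq_bigr => j _; exact: linearZ.
have E1 := cov_leibniz D fis Xs Vs x.
rewrite (_ : (fun y => _ *: V y) = (fun y => \sum_j a j y *: E j (i y))) in E1;
  last by apply/functional_extensionality_dep => y; exact: aE.
rewrite (cov_frame Xs X's X'E Es aS) big_split/= fp scale1r in E1.
have {E1} := congr1 (fun w => tderiv w h) E1.
rewrite /= !tderivDl tderivZl !tderiv_lin// => E1.
have : tderiv (X x) (fun y => (f \o i) y * tderiv (V y) h) =
    tderiv (X x) (fun y => \sum_j a j y * tderiv (E j (i y)) h).
  congr tderiv; apply/funext => y.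
  by rewrite -tderivZl/= aE tderiv_lin.
rewrite (tderivM _ fis VhS) (tderiv_sum _ _ (f := fun j y =>
  a j y * tderiv (E j (i y)) h)); last by move=> j; exact: (smooth_funM (aS j) (EhiS j)).
rewrite (eq_bigr (fun j => a j x * tderiv (X' (i x)) (fun q => tderiv (E j q) h)
  + tderiv (X x) (a j) * tderiv (E j (i x)) h)); last first.
  move=> j _; rewrite (tderivM _ (aS j) (EhiS j)); congr (_ + _).
    by rewrite X'E; congr (_ * _); exact/esym/(tderiv_differential hi _ (EhS j)).
  exact: mulrC.
rewrite big_split/= fp mul1r => E2.
have -> : nabla X' (fun q => \sum_j a j x *: E j q) (i x) =
    \sum_j a j x *: nabla X' (E j) (i x).
  apply: etrans (cov_sum nabla hid (index_enum _) (i x) X's cEs) _.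
  apply: eq_bigr => j _.
  apply: etrans (cov_leibniz nabla (smooth_fun_cst (a j x)) X's (Es j) (i x)) _.
  by rewrite tderiv_cst scale0r add0r.
have -> : tderiv (X' (i x)) (fun q => tderiv (\sum_j a j x *: E j q) h) =
    \sum_j a j x * tderiv (X' (i x)) (fun q => tderiv (E j q) h).
  have cEhS j : smooth_fun (fun q => a j x * tderiv (E j q) h).
    exact: (smooth_funM (smooth_fun_cst _) (EhS j)).
  apply: etrans (etrans (tderiv_sum (X' (i x)) (index_enum _) cEhS) _).
    by congr tderiv; apply/funext => q; rewrite tderiv_lin.
  apply: eq_bigr => j _; rewrite (tderivM _ (smooth_fun_cst _) (EhS j)).
  by rewrite tderiv_cst mulr0 addr0.
rewrite tderiv_lin//.
(* E1 is f V = sum a_j E_j differentiated covariantly and applied to h; E2 is the same equality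
   applied to h and then differentiated. The terms X(f) V h and X(a_j) E_j h occur in both and
   cancel. *)
have alg (p s1 s2 t u w : R) :
    p + s1 = w + t -> u + w = s2 + p -> t - u = s1 - s2.
  by clear; move=> *; lra.
by apply: (alg _ _ _ _ _ _ E1); rewrite -E2 [X in _ + X]mulrC.
Qed.

End pullback_connection.

(** Z is the bracket of X and Y. On a test function h, the push-forwards are replaced by ambient
    fields with the same values at i x and the same defect, to which the absence of torsion of
    [nabla] applies; what remains is X(Y(h o i)) - Y(X(h o i)). *)
Lemma pullback_torsion (R : realType) (m n : nat) (M : manifold R m)
    (N : manifold R n) (i : M -> N) (D : connection_along i)
    (nabla : connection N) (X Y : vfield M) (x : M) :
  smooth_map i -> is_pullback_connection nabla D -> torsion_free nabla ->
  smooth_vfield X -> smooth_vfield Y ->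
  exists Z : tangent x,
    D X (Defs.pushforward i Y) x - D Y (Defs.pushforward i X) x =
    differential i x Z.
Proof.
move=> hi hD tf Xs Ys; have [Z ZE] := lie_bracket_tangent x Xs Ys.
exists Z; apply/eqP; rewrite -subr_eq0; apply/eqP/tderiv_eq0 => h hs.
have iX := smooth_pushforward hi Xs; have iY := smooth_pushforward hi Ys.
have [X' [X's X'E HX]] := pullback_hessian hi hD x iX.
have [Y' [Y's Y'E HY]] := pullback_hessian hi hD x iY.
(* Each extension also serves as the direction in the identity of the other. *)
have H1 := HX Y Y' h Ys Y's Y'E hs.
have H2 := HY X X' h Xs X's X'E hs.
have H3 := tf X' Y' h X's Y's hs (i x).
have H4 := ZE (h \o i) (smooth_fun_comp hi hs).
have dE W : (fun y => tderiv (Defs.pushforward i W y) h) =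
    (fun y => tderiv (W y) (h \o i)).
  by apply/funext => y; exact: tderiv_differential.
rewrite !dE in H1 H2.
have tB (z : N) (v w : tangent z) : tderiv (v - w) h = tderiv v h - tderiv w h.
  exact: linearB.
rewrite tB in H3; rewrite !tB (tderiv_differential hi Z hs) -H4.
have alg (a b c d e f p q : R) : b - c = p - q -> a - d = e - f ->
    e - p = f - q -> a - b - (d - c) = 0.
  by clear; move=> *; lra.
exact: alg H1 H2 H3.
Qed.

(** * Metric duality of connections and tensors *)

Section metric.
Context {R : realType} {n : nat} {N : manifold R n}.
Variable g : riemannian_metric N.

Lemma metricDr (p : N) (u v w : tangent p) : g p u (v + w) = g p u v + g p u w.
Proof. by have := metric_linear g u 1 v w; rewrite scale1r mul1r. Qed.

Lemma metricZr (p : N) (a : R) (u v : tangent p) : g p u (a *: v) = a * g p u v.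
Proof.
have g0 : g p u 0 = 0.
  by apply: (addrI (g p u 0)); rewrite -metricDr !addr0.
by have := metric_linear g u a v 0; rewrite g0 !addr0.
Qed.

Lemma metricDl (p : N) (u v w : tangent p) : g p (v + w) u = g p v u + g p w u.
Proof. by rewrite !(metric_symmetric g _ u) metricDr. Qed.

Lemma metricBr (p : N) (u v w : tangent p) : g p u (v - w) = g p u v - g p u w.
Proof. by rewrite -scaleN1r metricDr metricZr mulN1r. Qed.

Lemma metric_eq0 (p : N) (u : tangent p) : g p u u = 0 -> u = 0.
Proof.
by move=> u0; apply/eqP/negPn/negP => /(metric_pos g); rewrite u0 ltxx.
Qed.

Lemma metric_nondegenerate (p : N) (u v : tangent p) :
  (forall w, g p w u = g p w v) -> u = v.
Proof.
move=> uv; apply/eqP; rewrite -subr_eq0; apply/eqP/metric_eq0.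
by rewrite metricBr uv subrr.
Qed.

(** Duality is stated for smooth fields, so equality is tested on these; the smooth field V - W is
    the test that decides. *)
Lemma metric_eq_fields (V W : vfield N) (p : N) :
  smooth_vfield V -> smooth_vfield W ->
  (forall X : vfield N, smooth_vfield X -> g p (X p) (V p) = g p (X p) (W p)) ->
  V p = W p.
Proof.
move=> Vs Ws VW; apply/eqP; rewrite -subr_eq0; apply/eqP/metric_eq0.
have hid := smooth_map_id N.
have Ds : smooth_vfield (fun q => V q + (-1) *: W q : tangent q).
  by apply: (smooth_alongD hid Vs); exact: (smooth_alongZ hid (smooth_fun_cst _)).
have := VW _ Ds; rewrite scaleN1r => VWE.
by rewrite metricBr VWE subrr.
Qed.

Variables nabla nablas : connection N.
Hypothesis hdual : dual_connections g nabla nablas.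

(** The functions g(F X, Y) and g(X, F^* Y) coincide. Differentiating both along Z by duality, the
    terms in [nabla] agree because F is parallel, hence so do those in [nablas]. *)
Lemma dual_parallel (F Fs : tensor11 N) :
  adjoint11 g F Fs -> parallel11 nabla F -> parallel11 nablas Fs.
Proof.
move=> hFs hF Z Y Zs Ys p.
have FsYs := tensor11_smooth Fs Ys.
apply/eqP; rewrite subr_eq0; apply/eqP.
apply: (metric_eq_fields (V := nablas Z (fun q => Fs q (Y q)))
  (W := fun q => Fs q (nablas Z Y q))).
- exact: cov_smooth.
- exact/tensor11_smooth/cov_smooth.
move=> X Xs; have FXs := tensor11_smooth F Xs.
have E1 := hdual Xs FsYs Zs p.
have E2 := hdual FXs Ys Zs p.
have FE : nabla Z (fun q => F q (X q)) p = F p (nabla Z X p).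
  by apply/eqP; rewrite -subr_eq0 (hF Z X Zs Xs p).
rewrite FE !hFs in E2.
have e : (fun q => g q (F q (X q)) (Y q)) = (fun q => g q (X q) (Fs q (Y q))).
  by apply/funext => q; exact: hFs.
by apply: (addIr (g p (nabla Z X p) (Fs p (Y p)))); rewrite -E1 -E2 e.
Qed.

(** By duality (nabla_X g)(Y, Z) = g(Y, nabla*_X Z - nabla_X Z), so total symmetry makes the
    difference of the two connections symmetric in X and Z, and their torsions equal. *)
Lemma dual_torsion_free : statistical g nabla -> torsion_free nablas.
Proof.
move=> [tf sym] X Z f Xs Zs fs p; rewrite -(tf X Z f Xs Zs fs p).
congr tderiv; apply/eqP; rewrite subr_eq addrAC -subr_eq opprK addrC; apply/eqP.
have hid := smooth_map_id N.
have nXZ := cov_smooth nabla Xs Zs; have nZX := cov_smooth nabla Zs Xs.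
have sXZ := cov_smooth nablas Xs Zs; have sZX := cov_smooth nablas Zs Xs.
apply: (metric_eq_fields (V := fun q => nablas X Z q + nabla Z X q : tangent q)
  (W := fun q => nablas Z X q + nabla X Z q : tangent q)).
- exact: smooth_alongD.
- exact: smooth_alongD.
move=> Y Ys; have := (sym X Y Z Xs Ys Zs p).1.
rewrite (sym Y X Z Ys Xs Zs p).2 (sym Y Z X Ys Zs Xs p).1.
rewrite /cov_metric (hdual Ys Zs Xs p) (hdual Ys Xs Zs p) !metricDr.
have alg (a b c d e r : R) : a + b - b - c = d + e - e - r -> a + r = d + c.
  by clear; move=> *; lra.
exact: alg.
Qed.

End metric.

(** * Tangential hypersurfaces *)

Section hypersurface.
Context {R : realType} {n : nat} {M : manifold R n} {M' : manifold R n.+1}.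
Variables (g : riemannian_metric M') (i : M -> M') (N : vfield_along i).
Hypotheses (hi : immersion i) (hN : unit_normal g N).

Lemma differential_inj (x : M) : injective (differential i x).
Proof. by case: hi => _; exact. Qed.

Lemma tangent_normal_unique (x : M) (u v : tangent x) (a b : R) :
  differential i x u + a *: N x = differential i x v + b *: N x ->
  u = v /\ a = b.
Proof.
case: hN => _ N1 Nt uv.
have ab : a = b.
  have := congr1 (g (i x) (N x)) uv; rewrite !metricDr !metricZr N1 !mulr1.
  by rewrite !(metric_symmetric g (N x)) !Nt !add0r.
by split=> //; apply: differential_inj; move: uv; rewrite ab => /addIr.
Qed.

(** Since g(X, F N) = g(F^* X, N), the field xi is metrically dual to the normal part of the
    adjoint; hence [eta] comes with [Fs] and [etas] with [F]. *)
Lemma induced_metric_xi (F Fs : tensor11 M') (xi : vfield M) (phi : tensor11 M)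
    (eta : one_form M) (xis : vfield M) (phis : tensor11 M) (etas : one_form M)
    (x : M) (v : tangent x) :
  adjoint11 g F Fs ->
  induced_structure N F xi phi etas -> induced_structure N Fs xis phis eta ->
  induced_metric g i v (xi x) = eta x v.
Proof.
move=> hFs [_ xiE _] [_ _ FsE]; case: hN => _ N1 Nt.
rewrite /induced_metric xiE metric_symmetric hFs FsE metricDr metricZr N1 mulr1.
by rewrite metric_symmetric Nt add0r.
Qed.

(** Normal parts of F(F N) = N and F(F X) = X. Here [eta] is the normal part of [F] itself, which
    for the F of the theorem is the form named [etas] there. *)
Lemma eta_xi (F : tensor11 M') (xi : vfield M) (phi : tensor11 M)
    (eta : one_form M) (x : M) :
  (forall (p : M') (u : tangent p), F p (F p u) = u) ->
  induced_structure N F xi phi eta ->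
  eta x (xi x) = 1 /\ forall v : tangent x, eta x (phi x v) = 0.
Proof.
move=> FF [_ xiE FE]; split=> [|v].
  have := FF (i x) (N x); rewrite -xiE FE -[N x in RHS]scale1r => E.
  have : differential i x (phi x (xi x)) + eta x (xi x) *: N x =
      differential i x 0 + 1 *: N x by rewrite linear0 add0r.
  by case/tangent_normal_unique.
have := FF (i x) (differential i x v).
rewrite FE linearD linearZ/= FE -xiE => E.
have : differential i x (phi x (phi x v) + eta x v *: xi x) +
    eta x (phi x v) *: N x = differential i x v + 0 *: N x.
  by rewrite scale0r addr0 -[RHS]E linearD linearZ/= addrAC.
by case/tangent_normal_unique.
Qed.

(** The torsion identity has a tangent right-hand side, the bracket, so its normal part is the
    symmetry. S is [As] for [D] and [A] for [Ds]. *)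
Lemma shape_operator_symmetric (D : connection_along i) (nabla' : connection M')
    (nabla : connection M) (S : tensor11 M) (X Y : vfield M) :
  is_pullback_connection nabla' D -> torsion_free nabla' ->
  (forall X Y : vfield M, smooth_vfield X -> smooth_vfield Y ->
    forall x : M, D X (Defs.pushforward i Y) x = differential i x (nabla X Y x) +
      induced_metric g i (S x (X x)) (Y x) *: N x) ->
  smooth_vfield X -> smooth_vfield Y -> forall x : M,
  induced_metric g i (S x (X x)) (Y x) = induced_metric g i (S x (Y x)) (X x).
Proof.
move=> hD tf gauss Xs Ys x.
have [Z] := pullback_torsion x hi.1 hD tf Xs Ys.
rewrite !gauss// => /eqP; rewrite subr_eq => /eqP E.
have : differential i x (nabla X Y x) +
    induced_metric g i (S x (X x)) (Y x) *: N x =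
    differential i x (Z + nabla Y X x) +
    induced_metric g i (S x (Y x)) (X x) *: N x.
  by rewrite E linearD addrA.
by case/tangent_normal_unique.
Qed.

(* Both halves of the theorem are instances of this lemma, for (nabla, F) and
   for the dual (nabla*, F* ), which has -kappa for kappa. *)
Lemma tangential_structure_equations (nabla' : connection M')
    (F Fs : tensor11 M') (D : connection_along i)
    (xi xis : vfield M) (phi phis : tensor11 M) (eta etas : one_form M)
    (nabla : connection M) (A As : tensor11 M) (X : vfield M) (k : M -> R) :
  (forall (p : M') (u : tangent p), F p (F p u) = u) ->
  parallel11 nabla' F -> adjoint11 g F Fs ->
  is_pullback_connection nabla' D ->
  induced_structure N F xi phi etas -> induced_structure N Fs xis phis eta ->
  smooth_vfield X ->
  (forall Y : vfield M, smooth_vfield Y ->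
    forall x : M, D X (Defs.pushforward i Y) x = differential i x (nabla X Y x) +
      induced_metric g i (As x (X x)) (Y x) *: N x) ->
  (forall x : M, D X N x = - differential i x (A x (X x)) + k x *: N x) ->
  forall x : M, [/\ nabla X xi x = - phi x (A x (X x)) + k x *: xi x,
    eta x (As x (X x)) + etas x (A x (X x)) = 0 &
    etas x (nabla X xi x) = k x].
Proof.
move=> FF hF hFs hD hxi hxis Xs gauss weingarten x.
have [xis' xiE FE] := hxi; have [Ns N1 Nt] := hN.
have FN : (fun y => F (i y) (N y) : tangent (i y)) = Defs.pushforward i xi.
  by apply/functional_extensionality_dep => y; rewrite -xiE.
have FNs : smooth_along (fun y => F (i y) (N y) : tangent (i y)).
  by rewrite FN; exact: smooth_pushforward hi.1 xis'.
have := pullback_parallel hi.1 hD hF Xs Ns FNs x.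
rewrite FN gauss// weingarten linearD linearN linearZ/= FE -xiE => E.
have [E1 E2] : nabla X xi x = - phi x (A x (X x)) + k x *: xi x /\
    induced_metric g i (As x (X x)) (xi x) = - etas x (A x (X x)).
  have dE : differential i x (- phi x (A x (X x)) + k x *: xi x) =
      - differential i x (phi x (A x (X x))) + k x *: differential i x (xi x).
    by rewrite linearD linearN linearZ.
  by apply: tangent_normal_unique; rewrite E dE opprD scaleNr addrAC.
have [etaxi etaphi] := eta_xi x FF hxi.
split=> //; first by rewrite -(induced_metric_xi _ hFs hxi hxis) E2 addNr.
by rewrite E1 linearD linearN linearZ/= etaxi etaphi oppr0 add0r mulr1.
Qed.

End hypersurface.

Theorem proposition5p1 (R : realType) (n : nat)
    (M' : manifold R n.+1) (g' : riemannian_metric M') (nabla' nablas' : connection M')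
    (F Fs : tensor11 M')
    (hM' : locally_product_like_statistical g' nabla' F)
    (hdual : dual_connections g' nabla' nablas')
    (hFs : adjoint11 g' F Fs)
    (M : manifold R n) (i : M -> M') (hi : immersion i)
    (N : vfield_along i) (hN : unit_normal g' N)
    (htan : tangential F Fs N)
    (xi xis : vfield M) (phi phis : tensor11 M) (eta etas : one_form M)
    (hF : induced_structure N F xi phi etas)
    (hFs' : induced_structure N Fs xis phis eta)
    (D Ds : connection_along i)
    (hD : is_pullback_connection nabla' D)
    (hDs : is_pullback_connection nablas' Ds)
    (nabla nablas : connection M) (A As : tensor11 M) (kappa : one_form M)
    (hGW : gauss_weingarten g' N D Ds nabla nablas A As kappa) :
  forall X : vfield M, smooth_vfield X ->
    [/\ forall x : M, nabla X xi x =
          - phi x (A x (X x)) + kappa x (X x) *: xi x,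
        forall x : M, nablas X xis x =
          - phis x (As x (X x)) - kappa x (X x) *: xis x,
        forall x : M, eta x (As x (X x)) + etas x (A x (X x)) = 0,
        forall x : M, A x (xis x) + As x (xi x) = 0
      & forall x : M, kappa x (X x) = etas x (nabla X xi x) /\
          etas x (nabla X xi x) = - eta x (nablas X xis x)].
Proof.
have [stat FF parF] := hM'; have [gauss wein gausss weins] := hGW.
have hFsF : adjoint11 g' Fs F.
  by move=> p u v; rewrite metric_symmetric -hFs metric_symmetric.
(* The square of the adjoint is the adjoint of the square. *)
have FsFs (p : M') (u : tangent p) : Fs p (Fs p u) = u.
  by apply: (metric_nondegenerate (g := g')) => w; rewrite -!hFs FF.
have parFs := dual_parallel hdual hFs parF.
have eqs X (Xs : smooth_vfield X) := tangential_structure_equations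
  (k := fun x => kappa x (X x)) hi hN FF parF hFs hD hF hFs' Xs
  (fun Y => gauss X Y Xs) (wein X Xs).
have weins' X (Xs : smooth_vfield X) x : Ds X N x =
    - differential i x (As x (X x)) + - kappa x (X x) *: N x.
  by rewrite scaleNr weins.
have eqss X (Xs : smooth_vfield X) := tangential_structure_equations
  (k := fun x => - kappa x (X x)) hi hN FsFs parFs hFsF hDs hFs' hF Xs
  (fun Y => gausss X Y Xs) (weins' X Xs).
move=> X Xs; split=> x.
- by have [] := eqs X Xs x.
- by have [-> _ _] := eqss X Xs x; rewrite scaleNr.
- by have [] := eqs X Xs x.
- have [xis_s _ _] := hFs'; have [xi_s _ _] := hF.
  (* The field that has to vanish is its own test field: self-adjointness turns g(W, W) into [etas]
     (A W) + [eta] (As W), which is the normal part of the equations for X = W. *)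
  pose W : vfield M := fun y => A y (xis y) + As y (xi y).
  have Ws : smooth_vfield W.
    by apply: (smooth_alongD (smooth_map_id M)); exact: tensor11_smooth.
  have tf := dual_torsion_free hdual stat.
  have symA := shape_operator_symmetric hi hN hDs tf gausss Ws xis_s x.
  have symAs := shape_operator_symmetric hi hN hD stat.1 gauss Ws xi_s x.
  rewrite (induced_metric_xi hN _ hFsF hFs' hF) in symA.
  rewrite (induced_metric_xi hN _ hFs hF hFs') in symAs.
  have [_ E _] := eqs W Ws x.
  apply: (differential_inj hi); rewrite linear0; apply: (metric_eq0 (g := g')).
  rewrite -[LHS]/(induced_metric g' i (W x) (W x)).
  have -> : induced_metric g' i (W x) (W x) =
      induced_metric g' i (A x (xis x)) (W x) +
      induced_metric g' i (As x (xi x)) (W x).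
    by rewrite /induced_metric -metricDl -linearD.
  by rewrite -symA -symAs addrC.
have [_ _ ->] := eqs X Xs x; have [_ _ ->] := eqss X Xs x.
by rewrite opprK.
Qed.
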